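(* Let $k\ge 2$, let $\pi$ be a degree sequence of $k$-uniform supertrees with at least one interior vertex, and let $\mathcal{T}_\pi$ be the class of all $k$-uniform supertrees with degree sequence $\pi$. A $k$-uniform supertree $\mathcal{G}$ with degree sequence $\pi$ has the Faber-Krahn property within the class $\mathcal{T}_\pi$ if and only if $\mathcal{G}$ has an SLO-ordering. Furthermore, such a $\mathcal{G}$ is uniquely determined up to isomorphism.
   Context: Hypergraphs are finite, without multiple edges; a hypergraph is $k$-uniform if every edge has exactly $k$ vertices. The degree $d(v)$ is the number of edges containing $v$. Distinct vertices $u,v$ are adjacent ($u\sim v$) if some edge contains both. A path from $u_1$ to $u_{p+1}$ is an alternating sequence $(u_1,e_1,u_2,\dots,e_p,u_{p+1})$ of distinct vertices and distinct edges with $u_i,u_{i+1}\in e_i$; if $u_1=u_{p+1}$ (the other vertices and the edges being distinct) it is a cycle. $\mathrm{dist}(u,v)$ is the length of a shortest path. A supertree is a connected acyclic hypergraph (so any two edges share at most one vertex). For a supertree, the boundary $\partial V$ is the set of all vertices of degree one and $V^\circ=V\setminus\partial V$ is the set of interior vertices. The degree sequence is the list of degrees of all vertices. The Laplacian of a $k$-uniform supertree is $L_{\mathcal{G}}f(u)=d(u)f(u)-\frac{1}{k-1}\sum_{v\sim u}f(v)$. A real $\lambda$ is a Dirichlet eigenvalue if there is a non-zero $f:V\to\mathbb{R}$ with $L_{\mathcal{G}}f(u)=\lambda f(u)$ for $u\in V^\circ$ and $f(u)=0$ for $u\in\partial V$. The first (smallest) Dirichlet eigenvalue is $$\lambda(\mathcal{G})=\min_f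 \frac{\sum_{\{u,v\}:\,u\sim v}\frac{1}{k-1}(f(u)-f(v))^2}{\sum_{v\in V}f(v)^2},$$ the minimum over non-zero $f:V\to\mathbb{R}$ with $f|_{\partial V}=0$ (the sum is over unordered pairs). $\mathcal{G}$ has the Faber-Krahn property within a class $\mathcal{C}$ if $\mathcal{G}\in\mathcal{C}$ and $\lambda(\mathcal{G})\le\lambda(\mathcal{H})$ for all $\mathcal{H}\in\mathcal{C}$. For a supertree with root $v_0$, the height is $h(v)=\mathrm{dist}(v,v_0)$; $u$ is a child of $v$ (and $v$ is the parent of $u$, which is unique) if $u\sim v$ and $h(u)=h(v)+1$. An SLO-ordering of a $k$-uniform supertree $\mathcal{G}$ with root $v_0$ is a well-ordering (total order) $\prec$ of the vertices such that: (S1) $u\prec v$ implies $h(u)\le h(v)$; (S2) if $u,v$ are the parents of $u_1,v_1$ respectively and $u\prec v$, then $u_1\prec v_1$; (S3) if $u\prec v$ and $u\in\partial V$, then $v\in\partial V$; (S4) if $e=\{u_1,\dots,u_k\}$ is an edge with $u_1\prec u_2\prec\cdots\prec u_k$, then there is no vertex $v\in V\setminus e$ with $u_i\prec v\prec u_{i+1}$ for some $2\le i\le k-1$; (S5) for $u,v\in V^\circ$, $u\prec v$ implies $d(u)\le d(v)$. $\mathcal{G}$ has an SLO-ordering if such an order exists for some choice of root $v_0$. *)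

(* Defs.v *)
From mathcomp Require Import all_boot all_order all_algebra.
From mathcomp Require Import all_classical all_reals.
From mathcomp Require Import topology normedtype derive.
From mathcomp Require Import ring lra.

Set Implicit Arguments.
Unset Strict Implicit.
Unset Printing Implicit Defensive.

Import Order.TTheory GRing.Theory Num.Theory.
Import numFieldNormedType.Exports.

Local Open Scope ring_scope.

Record hypergraph := Hypergraph {
  vert :> finType;
  hedges : {set {set vert}}
}.

Definition isomorphic (G H : hypergraph) : Prop :=
  exists2 phi : G -> H, bijective phi &
    forall e : {set G}, (phi @: e \in hedges H) = (e \in hedges G).

Definition deg (G : hypergraph) (v : G) : nat :=
  #|[set e in hedges G | v \in e]|.

Definition boundary_vertices (G : hypergraph) : {set G} :=
  [set v : G | deg v == 1%N].

Definition interior_vertices (G : hypergraph) : {set G} :=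
  ~: boundary_vertices G.

Definition adj (G : hypergraph) : rel G := fun u v =>
  (u != v) && [exists e in hedges G, (u \in e) && (v \in e)].

(* The alternating sequence (u_1, e_1, u_2, ..., e_p, u_{p+1}) is encoded by
   u_1 and the list [:: (e_1, u_2); ...; (e_p, u_{p+1})]. *)
Fixpoint hwalk (G : hypergraph) (u : G) (s : seq ({set G} * G)) : bool :=
  if s is (e, v) :: s' then
    [&& e \in hedges G, u \in e, v \in e & hwalk v s']
  else true.

Definition hpath (G : hypergraph) (u : G) (s : seq ({set G} * G)) : bool :=
  [&& hwalk u s, uniq (u :: unzip2 s) & uniq (unzip1 s)].

Definition hpath_between (G : hypergraph) (u v : G) (s : seq ({set G} * G)) :=
  hpath u s && (last u (unzip2 s) == v).

(* Length at least 2 excludes the degenerate closed sequences (u) and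
   (u, e, u); two edges sharing two vertices do form a cycle. *)
Definition hcycle (G : hypergraph) (u : G) (s : seq ({set G} * G)) : bool :=
  [&& (2 <= size s)%N, hwalk u s, last u (unzip2 s) == u,
      uniq (unzip2 s) & uniq (unzip1 s)].

Definition uniform (k : nat) (G : hypergraph) : Prop :=
  forall e, e \in hedges G -> #|e| = k.

Definition connected_hypergraph (G : hypergraph) : Prop :=
  forall u v : G, exists s, hpath_between u v s.

Definition acyclic_hypergraph (G : hypergraph) : Prop :=
  forall (u : G) s, ~~ hcycle u s.

Definition supertree (k : nat) (G : hypergraph) : Prop :=
  [/\ uniform k G, connected_hypergraph G & acyclic_hypergraph G].

Definition has_degree_sequence (pi : seq nat) (G : hypergraph) : Prop :=
  perm_eq pi [seq deg v | v <- enum G].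

Definition supertree_class (k : nat) (pi : seq nat) (G : hypergraph) : Prop :=
  supertree k G /\ has_degree_sequence pi G.

(* A path has at most #|G| - 1 edges; the value is #|G| if no path exists. *)
Definition dist (G : hypergraph) (u v : G) : nat :=
  find (fun p => [exists s : p.-tuple ({set G} * G)%type, hpath_between u v s])
       (iota 0 #|G|).

Definition height (G : hypergraph) (v0 v : G) : nat := dist v v0.

Definition is_parent (G : hypergraph) (v0 p c : G) : bool :=
  adj p c && (height v0 c == (height v0 p).+1).

Record SLO_ordering (G : hypergraph) (v0 : G) (lt : rel G) : Prop := {
  SLO_irr : irreflexive lt;
  SLO_trans : transitive lt;
  SLO_total : forall u v, u != v -> lt u v || lt v u;
  SLO_S1 : forall u v, lt u v -> (height v0 u <= height v0 v)%N;
  SLO_S2 : forall u v u1 v1, is_parent v0 u u1 -> is_parent v0 v v1 ->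
             lt u v -> lt u1 v1;
  SLO_S3 : forall u v, lt u v -> u \in boundary_vertices G ->
             v \in boundary_vertices G;
  (* s lists the edge e increasingly and is indexed from 0, so that the range
     2 <= i <= k - 1 becomes 0 < i and i + 1 < size s. *)
  SLO_S4 : forall (e : {set G}) (s : seq G),
             e \in hedges G -> sorted lt s -> s =i e ->
             forall i v, (0 < i)%N -> (i.+1 < size s)%N -> v \notin e ->
               ~~ (lt (nth v s i) v && lt v (nth v s i.+1));
  SLO_S5 : forall u v, u \in interior_vertices G -> v \in interior_vertices G ->
             lt u v -> (deg u <= deg v)%N
}.

Definition has_SLO_ordering (G : hypergraph) : Prop :=
  exists (v0 : G) (lt : rel G), SLO_ordering v0 lt.

Definition laplacian (R : realType) (k : nat) (G : hypergraph) (f : G -> R) :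
    G -> R :=
  fun u => (deg u)%:R * f u - (k.-1)%:R^-1 * \sum_(v | adj u v) f v.

Definition dirichlet_function (R : realType) (G : hypergraph) (f : G -> R) :
    Prop :=
  (exists v, f v != 0) /\ (forall v, v \in boundary_vertices G -> f v = 0).

Definition dirichlet_eigenvalue (R : realType) (k : nat) (G : hypergraph)
    (lam : R) : Prop :=
  exists2 f : G -> R, dirichlet_function f &
    forall u, u \in interior_vertices G -> laplacian k f u = lam * f u.

(* The double sum runs over ordered pairs, hence the factor 1/2. *)
Definition dirichlet_energy (R : realType) (k : nat) (G : hypergraph)
    (f : G -> R) : R :=
  2^-1 * \sum_u \sum_(v | adj u v) (k.-1)%:R^-1 * (f u - f v) ^+ 2.

Definition rayleigh (R : realType) (k : nat) (G : hypergraph) (f : G -> R) :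
    R :=
  dirichlet_energy k f / \sum_v f v ^+ 2.

(* This infimum is attained and is the least Dirichlet eigenvalue: see
   dirichlet_lambda_min and dirichlet_lambda_least_eigenvalue below. *)
Definition dirichlet_lambda (R : realType) (k : nat) (G : hypergraph) : R :=
  inf [set rayleigh k f | f in @dirichlet_function R G]%classic.

Definition faber_krahn (R : realType) (k : nat) (C : hypergraph -> Prop)
    (G : hypergraph) : Prop :=
  C G /\ forall H, C H -> dirichlet_lambda R k G <= dirichlet_lambda R k H.

Lemma sum_sq_gt0 (R : realType) (G : hypergraph) (f : G -> R) :
  (exists v, f v != 0) -> 0 < \sum_v f v ^+ 2.
Proof.
move=> [v fv]; rewrite (bigD1 v) //= ltr_wpDr ?exprn_even_gt0 //.
by apply: sumr_ge0 => u _; exact: sqr_ge0.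
Qed.

Lemma sum_sq_neq0 (R : realType) (G : hypergraph) (f : G -> R) :
  \sum_v f v ^+ 2 != 0 -> exists v, f v != 0.
Proof.
move=> h; apply: contrapT => /forallNP f0; move: h.
rewrite big1 ?eqxx // => v _.
by move: (f0 v) => /negP; rewrite negbK => /eqP ->; rewrite expr0n.
Qed.

Lemma dirichlet_energyZ (R : realType) k (G : hypergraph) (c : R) (f : G -> R) :
  dirichlet_energy k (fun v => c * f v) = c ^+ 2 * dirichlet_energy k f.
Proof.
rewrite /dirichlet_energy mulrCA; congr (_ * _); rewrite mulr_sumr.
apply: eq_bigr => u _; rewrite mulr_sumr; apply: eq_bigr => v _; ring.
Qed.

Lemma rayleighZ (R : realType) k (G : hypergraph) (c : R) (f : G -> R) :
  c != 0 -> rayleigh k (fun v => c * f v) = rayleigh k f.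
Proof.
move=> c0; rewrite /rayleigh dirichlet_energyZ.
under eq_bigr => v _ do rewrite exprMn.
by rewrite -mulr_sumr invfM mulrACA divff ?mul1r // expf_neq0.
Qed.

Lemma continuous_sum_fin (R : realType) (T : topologicalType) (I : finType)
    (P : pred I) (F : I -> T -> R) :
  (forall i, P i -> continuous (F i)) ->
  continuous (fun x => \sum_(i | P i) F i x).
Proof.
move=> cF; have -> : (fun x => \sum_(i | P i) F i x) = \sum_(i | P i) F i.
  by apply/funext => x; rewrite fct_sumE.
apply: (big_ind (fun h : T -> R => continuous h)) => //.
- by move=> x; exact: cvg_cst.
- by move=> f g cf cg x; apply: continuousD; [exact: cf|exact: cg].
Qed.

Lemma rayleigh_min_attained (R : realType) k (G : hypergraph) :
  (exists v, v \in interior_vertices G) ->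
  exists2 f : G -> R, dirichlet_function f &
    forall g : G -> R, dirichlet_function g -> rayleigh k f <= rayleigh k g.
Proof.
move=> [v0 v0i].
pose F (x : 'rV[R]_#|G|) (v : G) := x 0 (enum_rank v).
have cF v : continuous (F^~ v) by exact: coord_continuous.
pose N x := \sum_v F x v ^+ 2.
have cN : continuous N.
  apply: continuous_sum_fin => v _ x.
  by under eq_fun do rewrite expr2; apply: continuousM; exact: cF.
pose A : set 'rV[R]_#|G| :=
  [set x | N x = 1 /\ forall v, v \in boundary_vertices G -> F x v = 0]%classic.
have row_of (g : G -> R) : exists x, F x = g.
  exists (\row_i g (enum_val i)); apply/funext => v.
  by rewrite /F mxE enum_rankK.
have A0 : (A !=set0)%classic.
  have [x xE] := row_of (fun v => (v == v0)%:R).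
  exists x; split.
    rewrite /N xE (bigD1 v0) //= eqxx expr1n big1 ?addr0 // => v /negPf ->.
    by rewrite expr0n.
  move=> v vb; rewrite xE; case: eqP => // vE; move: v0i.
  by rewrite /interior_vertices finset.in_setC -vE vb.
have cA : compact A.
  apply: bounded_closed_compact.
    exists 1; split => // M M1 x [Nx _] /=.
    rewrite /Num.norm /= mx_normrE; apply/bigmax_leP; split=> [|[i j] _] /=.
      exact: ltW (lt_trans ltr01 M1).
    apply: le_trans (ltW M1); rewrite -(@ler_pXn2r _ 2) ?nnegrE //.
    rewrite expr1n real_normK ?num_real // -Nx /N (bigD1 (enum_val j)) //=.
    rewrite /F enum_valK ord1 lerDl; apply: sumr_ge0 => v _; exact: sqr_ge0.
  have -> : A = ((N @^-1` [set 1]) `&`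
     \bigcap_(v in [set v | v \in boundary_vertices G]) (F^~ v @^-1` [set 0]))%classic.
    by apply/seteqP; split => x [].
  apply: closedI; first by apply: preimage_closed => [x _|]; [exact: cN|exact: closed_eq].
  apply: closed_bigI => v _.
  by apply: preimage_closed => [x _|]; [exact: cF|exact: closed_eq].
have cE : continuous (fun x => dirichlet_energy k (F x)).
  have cZ (c : R) (h : 'rV[R]_#|G| -> R) :
      continuous h -> continuous (fun x => c * h x).
    by move=> ch x; exact: (cvgM (cvg_cst c) (ch x)).
  apply: (cZ _ _); apply: continuous_sum_fin => u _; apply: continuous_sum_fin => v _.
  apply: cZ => x; under eq_fun do rewrite expr2.
  have cB : {for x, continuous (fun x => F x u - F x v)}.
    exact: (cvgB (cF u x) (cF v x)).
  exact: (cvgM cB cB).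
have [x /set_mem[Nx bx] xmin] := compact_EVT_min A0 cA (continuous_subspaceT cE).
have rE y : N y = 1 -> rayleigh k (F y) = dirichlet_energy k (F y).
  by rewrite /rayleigh -/(N y) => ->; rewrite divr1.
exists (F x).
  by split=> //; apply: sum_sq_neq0; rewrite -/(N x) Nx oner_neq0.
move=> g [g0 gb]; have Ng := sum_sq_gt0 g0.
pose c := (Num.sqrt (\sum_v g v ^+ 2))^-1.
have c0 : c != 0 by rewrite invr_neq0 // gt_eqF // sqrtr_gt0.
have [y yE] := row_of (fun v => c * g v).
have Ny : N y = 1.
  rewrite /N yE; under eq_bigr do rewrite exprMn.
  by rewrite -mulr_sumr exprVn sqr_sqrtr ?ltW // mulVf // gt_eqF.
rewrite -(rayleighZ k g c0) -yE !rE //; apply: xmin; rewrite inE; split=> //.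
by move=> v vb; rewrite yE gb // mulr0.
Qed.

Lemma dirichlet_lambda_min (R : realType) k (G : hypergraph) :
  (exists v, v \in interior_vertices G) ->
  exists2 f : G -> R, dirichlet_function f &
    dirichlet_lambda R k G = rayleigh k f /\
    forall g : G -> R, dirichlet_function g -> rayleigh k f <= rayleigh k g.
Proof.
move=> /(rayleigh_min_attained R k)[f df fmin]; exists f => //; split=> //.
apply/eqP; rewrite eq_le; apply/andP; split.
  apply: ge_inf; last by exists f.
  by exists (rayleigh k f) => _ [g dg <-]; exact: fmin.
apply: lb_le_inf; first by exists (rayleigh k f), f.
by move=> _ [g dg <-]; exact: fmin.
Qed.

Lemma edges_meet_once k (G : hypergraph) (e e' : {set G}) (u v : G) :
  supertree k G -> e \in hedges G -> e' \in hedges G -> u != v ->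
  u \in e -> v \in e -> u \in e' -> v \in e' -> e = e'.
Proof.
move=> [_ _ acG] eG e'G uv ue ve ue' ve'; apply/eqP/negPn/negP => ee'.
move: (acG u [:: (e, v); (e', u)]).
by rewrite /hcycle /= eG e'G ue ve ue' ve' eqxx !inE eq_sym uv ee'.
Qed.

Lemma card_adj k (G : hypergraph) (u : G) :
  supertree k G -> #|[pred v | adj u v]| = (deg u * k.-1)%N.
Proof.
move=> stG; have [uG _ _] := stG.
have cE v : (adj u v : nat) =
    (\sum_(e in hedges G | u \in e) (v \in e :\ u)%SET)%N.
  have [auv|auv] := boolP (adj u v).
    have /andP[uv /existsP[e /andP[eG /andP[ue ve]]]] := auv.
    rewrite (bigD1 e) /= ?eG ?ue // !inE eq_sym uv ve big1 // => e'.
    move=> /andP[/andP[e'G ue'] ee']; rewrite !inE eq_sym uv /=.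
    case: (boolP (v \in e')) => // ve'.
    by rewrite (edges_meet_once stG e'G eG uv) ?eqxx in ee'.
  rewrite big1 // => e /andP[eG ue]; rewrite !inE.
  case: eqVneq => //= vu; case: (boolP (v \in e)) => // ve.
  case/negP: auv; rewrite /adj eq_sym vu; apply/existsP; exists e.
  by rewrite eG ue ve.
rewrite -sum1_card big_mkcond /=.
under eq_bigr => v _.
  have -> : (if v \in [pred v | adj u v] then 1%N else 0%N) = adj u v by [].
  rewrite cE; over.
rewrite exchange_big /= /deg -sum1_card big_distrl /=.
rewrite [RHS](eq_bigl (fun e => (e \in hedges G) && (u \in e))); last first.
  by move=> e; rewrite inE.
apply: eq_bigr => e /andP[eG ue]; rewrite mul1n.
rewrite -(uG e eG) (cardsD1 u e) ue /= -sum1_card.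
by rewrite add0n [RHS]big_mkcond; apply: eq_bigr => i _; case: (i \in _).
Qed.

Lemma energy_green (R : realType) k (G : hypergraph) (f g : G -> R) :
  (2 <= k)%N -> supertree k G ->
  2^-1 * \sum_u \sum_(v | adj u v)
    (k.-1)%:R^-1 * ((f u - f v) * (g u - g v)) =
  \sum_u g u * laplacian k f u.
Proof.
move=> k2 stG; have k0 : (k.-1)%:R != 0 :> R.
  by rewrite pnatr_eq0; case: k k2 {stG} => [|[]].
pose S := \sum_u \sum_(v | adj u v) (k.-1)%:R^-1 * ((f u - f v) * g u).
have adjC (u v : G) : adj u v = adj v u.
  rewrite /adj eq_sym; congr (_ && _); apply: eq_existsb => e.
  by rewrite (andbC (u \in e)).
have SE : S = \sum_u \sum_(v | adj u v) (k.-1)%:R^-1 * ((f v - f u) * g v).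
  rewrite /S (exchange_big_dep xpredT) //=; apply: eq_bigr => u _.
  by apply: eq_bigl => v; rewrite adjC.
have -> : \sum_u \sum_(v | adj u v)
    (k.-1)%:R^-1 * ((f u - f v) * (g u - g v)) = S + S.
  rewrite {2}SE /S -big_split /=; apply: eq_bigr => u _.
  by rewrite -big_split /=; apply: eq_bigr => v _; ring.
have -> : 2^-1 * (S + S) = S by field.
apply: eq_bigr => u _; rewrite -mulr_sumr -mulr_suml sumrB /laplacian.
have -> : \sum_(v | adj u v) f u = (deg u * k.-1)%:R * f u.
  by rewrite -(card_adj u stG) sumr_const mulr_natl.
by rewrite natrM; field.
Qed.

Lemma energy_laplacian (R : realType) k (G : hypergraph) (f : G -> R) :
  (2 <= k)%N -> supertree k G ->
  dirichlet_energy k f = \sum_u f u * laplacian k f u.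
Proof. by move=> k2 stG; rewrite -(energy_green f f k2 stG). Qed.

Lemma lin_quad_ge0 (R : realType) (a b : R) :
  (forall t, 0 <= t * a + t ^+ 2 * b) -> a = 0.
Proof.
move=> h; apply/eqP; apply: contraT => a0.
have b1 : 0 < `|b| + 1 by rewrite ltr_wpDl.
have := h (- a / (`|b| + 1)).
have -> : - a / (`|b| + 1) * a + (- a / (`|b| + 1)) ^+ 2 * b =
    - (a ^+ 2 / (`|b| + 1) ^+ 2) * (`|b| + 1 - b) by field; rewrite gt_eqF.
rewrite mulNr oppr_ge0 leNgt => /negP[].
rewrite mulr_gt0 ?divr_gt0 ?exprn_even_gt0 //= ?gt_eqF //.
by rewrite subr_gt0 (le_lt_trans (ler_norm b)) // ltrDl.
Qed.

Lemma dirichlet_lambda_least_eigenvalue (R : realType) k (G : hypergraph) :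
  (2 <= k)%N -> supertree k G -> (exists v, v \in interior_vertices G) ->
  dirichlet_eigenvalue k G (dirichlet_lambda R k G) /\
  forall mu : R, dirichlet_eigenvalue k G mu -> dirichlet_lambda R k G <= mu.
Proof.
move=> k2 stG iG; have [f df [-> fmin]] := dirichlet_lambda_min R k iG.
split; last first.
  move=> mu [g dg gmu]; apply: le_trans (fmin _ dg) _.
  have Ng := sum_sq_gt0 dg.1.
  rewrite /rayleigh ler_pdivrMr // (energy_laplacian g k2 stG) mulr_sumr.
  rewrite le_eqVlt (eq_bigr (fun u => mu * g u ^+ 2)) ?eqxx // => u _.
  have [ub|ui] := boolP (u \in boundary_vertices G).
    by rewrite dg.2 // mul0r expr0n mulr0.
  by rewrite gmu ?finset.in_setC //; ring.
exists f => // w wi; set lam := rayleigh k f.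
have wb : w \notin boundary_vertices G by rewrite -finset.in_setC.
have low (g : G -> R) : (forall v, v \in boundary_vertices G -> g v = 0) ->
    lam * \sum_v g v ^+ 2 <= dirichlet_energy k g.
  move=> gb; have [g0|g0] := eqVneq (\sum_v g v ^+ 2) 0.
    rewrite g0 mulr0 mulr_ge0 ?invr_ge0 //.
    apply: sumr_ge0 => u _; apply: sumr_ge0 => v _.
    by rewrite mulr_ge0 ?sqr_ge0 ?invr_ge0.
  have g1 := sum_sq_neq0 g0.
  by rewrite -ler_pdivlMr ?sum_sq_gt0 //; exact: fmin.
pose d v : R := (v == w)%:R.
have sum_d (h : G -> R) : \sum_v d v * h v = h w.
  rewrite (bigD1 w) //= /d eqxx mul1r big1 ?addr0 // => v /negPf ->.
  by rewrite mul0r.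
have Ef : dirichlet_energy k f = lam * \sum_v f v ^+ 2.
  by rewrite /lam /rayleigh divfK // gt_eqF // sum_sq_gt0 //; exact: df.1.
have key t : 0 <= t * (2 * (laplacian k f w - lam * f w)) +
    t ^+ 2 * (dirichlet_energy k d - lam * \sum_v d v ^+ 2).
  have := low (fun v => f v + t * d v).
  have -> : \sum_v (f v + t * d v) ^+ 2 =
      \sum_v f v ^+ 2 + 2 * t * f w + t ^+ 2 * \sum_v d v ^+ 2.
    rewrite -(sum_d f) !mulr_sumr -!big_split /=.
    by apply: eq_bigr => v _; ring.
  have -> : dirichlet_energy k (fun v => f v + t * d v) =
      dirichlet_energy k f + 2 * t * laplacian k f w +
      t ^+ 2 * dirichlet_energy k d.
    rewrite -(sum_d (laplacian k f)) -(energy_green f d k2 stG).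
    rewrite /dirichlet_energy ![_ * (2^-1 * _)]mulrCA -!mulrDr; congr (_ * _).
    rewrite !mulr_sumr -!big_split /=; apply: eq_bigr => u _.
    rewrite !mulr_sumr -!big_split /=; apply: eq_bigr => v _; ring.
  move=> H; have {H}/H : forall v, v \in boundary_vertices G -> f v + t * d v = 0.
    move=> v vb; rewrite df.2 // /d; case: eqVneq => [vw|_].
      by rewrite -vw vb in wb.
    by rewrite mulr0 addr0.
  by rewrite Ef; lra.
by have := lin_quad_ge0 key; lra.
Qed.

(* Main.v *)
Require Import Defs.
From mathcomp Require Import all_boot all_order all_algebra all_fingroup.
From mathcomp Require Import boolp all_reals.
From mathcomp Require Import zify ring lra.

(* Multiplied by [k - 1], the Dirichlet energy of [f] is
   [k * \sum_v d(v) f(v)^2 - \sum_e f(e)^2] with [f(e) = \sum_(x in e) f x], so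
   exchanging two vertices between edges, or moving edges from one vertex to
   another, changes it in an explicit way.  Let [f] be a nonnegative first
   eigenfunction of an extremal tree.  No exchange may lower the energy, and one
   that keeps it yields a tree with the same eigenfunction, hence with the same
   Laplacian of [f].  Rooting the tree at a maximum of [f], these conditions
   force [f] to be non-increasing along the order that compares first heights,
   then parents, then parent edges [e] by decreasing [f(e)], then values of [f];
   this order is an SLO-ordering.  Conversely the degree sequence determines a
   tree with an SLO-ordering, since the ranks of the vertices determine their
   degrees, their parents and their parent edges.  A minimizer exists in the
   class, so it is the only tree with an SLO-ordering. *)

Set Implicit Arguments.
Unset Strict Implicit.
Unset Printing Implicit Defensive.

Import Order.TTheory GRing.Theory Num.Theory.

(** * Connectivity through edges *)

Section Connectivity.
Variable T : finType.
Implicit Types (E S : {set {set T}}) (e : {set T}) (x y z u v : T).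

(** The obstacle is ties. If [f u = f v], trading branches of [u] and [v] leaves the energy
    unchanged, so minimality by itself says nothing about degrees or edge sums. What helps is that
    the change of the Laplacian at a vertex is an explicit expression, which must then vanish. It
    follows that interior vertices with equal values have equal degrees, and that the edges by which
    they point towards each other have equal sums; the monotonicity proofs end by contradicting this
    last equality. Competitors must stay in the class and keep [f] admissible. Exchanging two
    vertices between edges keeps all degrees; moving edges from [u] to [v] moves exactly the surplus
    of degree, so that two interior vertices trade their degrees. Cycles in a competitor are never
    examined: a connected [k]-uniform hypergraph with few enough edges is a hypertree by counting,
    so only connectivity has to be checked. *)

Definition edge_rel E : rel T :=
  fun x y => [exists e in E, (x \in e) && (y \in e)].

Definition conn E : rel T := connect (edge_rel E).

Lemma edge_relP E x y :
  reflect (exists e, [/\ e \in E, x \in e & y \in e]) (edge_rel E x y).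
Proof.
apply: (iffP existsP) => [[e /and3P[eE xe ye]]|[e [eE xe ye]]]; exists e => //.
by rewrite eE xe ye.
Qed.

Lemma connxx E x : conn E x x. Proof. exact: connect0. Qed.

Lemma conn_trans E y x z : conn E x y -> conn E y z -> conn E x z.
Proof. exact: connect_trans. Qed.

Lemma conn_sym E x y : conn E x y = conn E y x.
Proof.
apply: sym_connect_sym => {}x {}y; apply/edge_relP/edge_relP;
  by case=> e [eE xe ye]; exists e.
Qed.

Lemma conn_edge E e x y : e \in E -> x \in e -> y \in e -> conn E x y.
Proof. by move=> eE xe ye; apply: connect1; apply/edge_relP; exists e. Qed.

Lemma conn_ind E (P : T -> Prop) x y :
  P x ->
  (forall a b e, P a -> e \in E -> a \in e -> b \in e -> P b) ->
  conn E x y -> P y.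
Proof.
move=> Px step /connectP[p pp ->]; elim: p x Px pp => //= b p IH a Pa.
by case/andP=> /edge_relP[e [eE ae be]]; apply: IH; apply: step Pa eE ae be.
Qed.

Lemma conn_mono E E' x y :
  (forall e a b, e \in E -> a \in e -> b \in e -> conn E' a b) ->
  conn E x y -> conn E' x y.
Proof.
move=> sub; apply: (conn_ind (P := conn E' x)); first exact: connxx.
move=> a b e xa eE ae be.
exact: conn_trans xa (sub e a b eE ae be).
Qed.

Lemma conn_subset E E' x y : E \subset E' -> conn E x y -> conn E' x y.
Proof.
move=> /subsetP sub; apply: conn_mono => e a b /sub; exact: conn_edge.
Qed.

(** Acyclicity by deletion: without an edge, its vertices lie in distinct components. Arguments
    about cycles become arguments about connectivity in [E :\ e]. *)
Definition forest E : Prop :=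
  forall e x y, e \in E -> x \in e -> y \in e -> conn (E :\ e) x y -> x = y.

Lemma forest_meet E e e' x y : forest E -> e \in E -> e' \in E ->
  x \in e -> y \in e -> x \in e' -> y \in e' -> x != y -> e = e'.
Proof.
move=> fE eE e'E xe ye xe' ye' xy; apply/eqP/negPn/negP => ee'.
move/eqP: xy; apply; apply: (fE e) => //; apply: (conn_edge (e := e')) => //.
by rewrite !inE eq_sym ee'.
Qed.

(** A walk from [y] that used an edge of [S] would reach [z]. *)
Lemma conn_avoid E S y v z :
  (forall e, e \in S -> z \in e) -> ~~ conn E y z ->
  conn E y v -> conn (E :\: S) y v.
Proof.
move=> Sz nyz yv; suff [] : conn E y v /\ conn (E :\: S) y v by [].
apply: (conn_ind (P := fun x => conn E y x /\ conn (E :\: S) y x)) yv.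
  by split; exact: connxx.
move=> a b e [ya ya'] eE ae be; have eS : e \notin S.
  apply: contra nyz => /Sz ze; exact: conn_trans ya (conn_edge eE ae ze).
split; first exact: conn_trans ya (conn_edge eE ae be).
by apply: conn_trans ya' (conn_edge (e := e) _ ae be); rewrite inE eS.
Qed.

Lemma conn_avoid1 E e y v z : z \in e -> ~~ conn E y z ->
  conn E y v -> conn (E :\ e) y v.
Proof. by move=> ze; apply: conn_avoid => e' /set1P ->. Qed.

(** Consider the last edge [e] of [S] on a walk from [u] to [v], left through some [y != u]. From
    [y] the walk reaches [v] without [e], and by hypothesis so does [u]; then two vertices of [e]
    are connected outside [e]. *)
Lemma conn_drop_edges E E' S u v :
  forest E -> E' \subset E -> conn E' u v ->
  (forall e, e \in S -> u \in e /\ conn (E :\ e) u v) ->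
  conn (E' :\: S) u v.
Proof.
move=> fE sub uv Su.
have : conn (E' :\: S) u v \/ exists e y,
    [/\ e \in S, e \in E', y \in e, y != u & conn (E' :\: S) y v].
  apply: (conn_ind (P := fun x => conn (E' :\: S) u x \/ exists e y,
    [/\ e \in S, e \in E', y \in e, y != u & conn (E' :\: S) y x])) uv.
    by left; exact: connxx.
  move=> a b e Pa eE ae be; have [eS|eS] := boolP (e \in S).
    have [->|bu] := eqVneq b u; first by left; exact: connxx.
    by right; exists e, b; split=> //; exact: connxx.
  have ab : conn (E' :\: S) a b by apply: conn_edge ae be; rewrite inE eS.
  case: Pa => [ua|[e' [y [e'S e'E ye yu ya]]]]; first by left; apply: conn_trans ab.
  by right; exists e', y; split=> //; apply: conn_trans ab.
case=> // -[e [y [eS eE ye yu yv]]]; have [ue uve] := Su _ eS.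
case/eqP: yu; symmetry; apply: (fE e) => //; first exact: (subsetP sub).
rewrite conn_sym; apply: conn_trans (_ : conn (E :\ e) y v) _; last first.
  by rewrite conn_sym.
apply: conn_subset yv; apply: setDSS => //; by rewrite sub1set.
Qed.

Lemma path_edge E u v : forest E -> conn E u v -> u != v ->
  exists g, [/\ g \in E, u \in g, ~~ conn (E :\ g) u v &
    forall e, e \in E -> u \in e -> e != g -> conn (E :\ e) u v].
Proof.
move=> fE uv nuv.
(* Invariant along a walk from [u]: since its last visit to [u] it has left through [g], and from
   the end [y] of its last use of [g] it goes on without [g]. *)
have : v = u \/ exists g y,
    [/\ g \in E, u \in g, y \in g, y != u & conn (E :\ g) y v].
  apply: (conn_ind (P := fun x => x = u \/ exists g y,
    [/\ g \in E, u \in g, y \in g, y != u & conn (E :\ g) y x])) uv.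
    by left.
  move=> a b e Pa eE ae be; have [->|bu] := eqVneq b u; first by left.
  right; case: Pa => [au|[g [y [gE ug yg yu ya]]]].
    by subst a; exists e, b; split=> //; exact: connxx.
  have [eg|eg] := eqVneq e g.
    by subst g; exists e, b; split=> //; exact: connxx.
  exists g, y; split=> //; apply: conn_trans ya (conn_edge (e := e) _ ae be).
  by rewrite !inE eg.
case=> [vu|[g [y [gE ug yg yu yv]]]]; first by rewrite vu eqxx in nuv.
have nyu : ~~ conn (E :\ g) y u.
  by apply/negP => c; case/eqP: yu; apply: (fE g).
exists g; split=> //.
  apply/negP => uv'; case/negP: nyu; apply: conn_trans yv _.
  by rewrite conn_sym.
move=> e eE ue eg; apply: conn_trans (_ : conn _ u y) _.
  by apply: (conn_edge (e := g)) => //; rewrite !inE eq_sym eg.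
apply: conn_subset (conn_avoid1 ue nyu yv); apply: setSD; exact: subD1set.
Qed.

Definition hypertree k E : Prop :=
  [/\ forall e, e \in E -> #|e| = k, forall x y, conn E x y & forest E].

Definition degree E v := #|[set e in E | v \in e]|.

End Connectivity.

(** * Supertrees and distances in terms of connectivity *)

Section SupertreeHypertree.
Variable T : finType.
Implicit Types (E : {set {set T}}).

Lemma hwalk_conn E E' u (s : seq ({set T} * T)) :
  @hwalk (@Hypergraph T E) u s -> {subset unzip1 s <= E'} ->
  conn E' u (last u (unzip2 s)).
Proof.
elim: s u => [|[e v] s IH] u /=; first by move=> _ _; exact: connxx.
case/and4P=> eE ue ve ws sub.
have vl : conn E' v (last v (unzip2 s)).
  by apply: IH => // g gs; apply: sub; rewrite inE gs orbT.
by apply: conn_trans (conn_edge _ ue ve) vl; apply: sub; rewrite mem_head.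
Qed.

Lemma hwalk_mem E u (s : seq ({set T} * T)) :
  @hwalk (@Hypergraph T E) u s -> {subset unzip1 s <= E}.
Proof.
elim: s u => [|[e v] s IH] u //= /and4P[eE _ _ ws] g; rewrite inE.
by case/predU1P=> [->//|]; exact: IH ws _.
Qed.

Lemma hwalk_sub E E' u (s : seq ({set T} * T)) : E \subset E' ->
  @hwalk (@Hypergraph T E) u s -> @hwalk (@Hypergraph T E') u s.
Proof.
move=> /subsetP sub; elim: s u => [|[e v] s IH] u //=.
by case/and4P=> /sub -> -> -> /IH ->.
Qed.

Lemma hpath_suffix E u (s : seq ({set T} * T)) x :
  @hpath (@Hypergraph T E) u s -> x \in u :: unzip2 s ->
  exists s', [/\ @hpath (@Hypergraph T E) x s',
    last x (unzip2 s') = last u (unzip2 s) & (size s' <= size s)%N].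
Proof.
elim: s u => [|[e v] s IH] u ps.
  by rewrite inE => /eqP ->; exists [::]; split.
rewrite inE => /predU1P[->|]; first by exists ((e, v) :: s); split.
case/and3P: ps => /= /and4P[_ _ _ ws] /andP[_ us] /andP[_ us'] xs.
have ps : @hpath (@Hypergraph T E) v s by apply/and3P.
have [s' [ps' ls' sz]] := IH _ ps xs; exists s'; split=> //=.
exact: leqW.
Qed.

Lemma hwalk_split E u e (s : seq ({set T} * T)) :
  @hwalk (@Hypergraph T E) u s -> e \in unzip1 s -> exists y s1 s2,
  [/\ s = s1 ++ (e, y) :: s2, e \in E, y \in e & @hwalk (@Hypergraph T E) y s2].
Proof.
elim: s u => [|[g v] s IH] u //= /and4P[gE ug vg ws]; rewrite inE.
case/predU1P=> [->|es]; first by exists v, [::], s.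
have [y [s1 [s2 [-> eE ye w2]]]] := IH _ ws es.
by exists y, ((g, v) :: s1), s2.
Qed.

(** Prepending [e] may repeat a vertex or an edge. If [b] was visited, the suffix from [b] is
    enough; if [e] was used, jump along [e] to the vertex through which the path leaves it. *)
Lemma hpath_step E e a b v (s : seq ({set T} * T)) :
  e \in E -> a \in e -> b \in e -> @hpath_between (@Hypergraph T E) a v s ->
  exists s', @hpath_between (@Hypergraph T E) b v s' /\ (size s' <= (size s).+1)%N.
Proof.
move=> eE ae be /andP[ps /eqP ls].
have [bs|bs] := boolP (b \in a :: unzip2 s).
  have [s' [ps' ls' sz]] := hpath_suffix ps bs.
  by exists s'; rewrite /hpath_between ps' ls' ls eqxx (leqW sz).
have [ws us us'] := and3P ps.
have [es|es] := boolP (e \in unzip1 s); last first.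
  exists ((e, a) :: s); split=> //; apply/andP; split; last by rewrite /= ls.
  by apply/and3P; split; rewrite /= ?eE ?be ?ae ?ws ?es //; exact/andP.
have [y [s1 [s2 [sE _ ye ws2]]]] := hwalk_split ws es.
exists ((e, y) :: s2); split; last first.
  by rewrite /= ltnS sE size_cat /= addnS ltnW // ltnS leq_addl.
rewrite /hpath_between /hpath /= eE be ye ws2 /=.
move: us us' bs ls; rewrite sE /unzip1 /unzip2 !map_cat !map_cons last_cat /=.
rewrite !mem_cat !inE !mem_cat !inE !cat_uniq /= !negb_or.
case/andP=> _ /and3P[_ _ /andP[-> ->]]; case/and3P=> _ _ /andP[-> ->].
by case/and4P=> _ _ -> bs2 ->; rewrite eqxx andbT /= bs2.
Qed.

Lemma conn_hpath E u v : conn E u v ->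
  exists s, @hpath_between (@Hypergraph T E) u v s.
Proof.
rewrite conn_sym; apply: (conn_ind (P := fun x =>
  exists s, @hpath_between (@Hypergraph T E) x v s)).
  by exists [::]; rewrite /hpath_between /hpath /= eqxx.
by move=> a b e [s ps] eE ae be; have [s' []] := hpath_step eE ae be ps; exists s'.
Qed.

Lemma supertreeP k E :
  supertree k (@Hypergraph T E) <-> hypertree k E.
Proof.
split=> [[uE cE aE]|[uE cE fE]]; split=> //.
- move=> x y; have [s /andP[/and3P[ws _ _] /eqP <-]] := cE x y.
  by apply: (hwalk_conn ws); exact: (hwalk_mem ws).
- move=> e x y eE xe ye c; apply/eqP/negPn/negP => xy.
  have [s /andP[/and3P[ws us us'] /eqP ls]] := conn_hpath c.
  move: (aE y ((e, x) :: s)) => /negP; apply; apply/and5P; split.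
  - by case: s ls {ws us us'} => //= xyE; rewrite xyE eqxx in xy.
  - by apply/and4P; split=> //; apply: hwalk_sub ws; exact: subD1set.
  - exact/eqP.
  - exact: us.
  - rewrite /= us' andbT; apply/negP => /(hwalk_mem ws).
    by rewrite !inE eqxx.
- by move=> x y; exact: conn_hpath.
- move=> u [|[e v] s] //; apply/negP; rewrite /hcycle /= ltnS.
  case/andP=> s0 /and4P[/and4P[eE ue ve ws] /eqP ls /andP[vs _] /andP[es _]].
  (* After its first edge a cycle returns to [u] without that edge. The forest condition gives
     [v = u], against the distinctness of the vertices. *)
  have vu : conn (E :\ e) v u.
    rewrite -ls; apply: (hwalk_conn ws) => g gs.
    by rewrite !inE (hwalk_mem ws gs) andbT; apply: contraNneq es => <-.
  have := fE _ _ _ eE ve ue vu => vuE.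
  case: s s0 ls vs {ws es} => // -[g w] s _ /= ls /negP[].
  by rewrite vuE -ls mem_last.
Qed.

Lemma dist_le E u v s :
  @hpath_between (@Hypergraph T E) u v s -> (@dist (@Hypergraph T E) u v <= size s)%N.
Proof.
move=> ps; rewrite leqNgt; apply/negP => lt.
have := before_find 0 lt; rewrite nth_iota; last first.
  apply: leq_trans lt _; by rewrite /dist -[X in (_ <= X)%N](size_iota 0 #|T|) find_size.
rewrite add0n => /existsP[]; by exists (in_tuple s).
Qed.

Lemma dist_hpath E u v : conn E u v ->
  exists2 s, @hpath_between (@Hypergraph T E) u v s &
    size s = @dist (@Hypergraph T E) u v.
Proof.
move=> /conn_hpath[s ps]; pose a p :=
  [exists t : p.-tuple ({set T} * T)%type, @hpath_between (@Hypergraph T E) u v t].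
(* A path has distinct vertices, so its length lies in the search range of [dist]. *)
have hasa : has a (iota 0 #|T|).
  apply/hasP; exists (size s); last by apply/existsP; exists (in_tuple s).
  have /andP[/and3P[_ us _] _] := ps.
  have := uniq_leq_size us (fun x _ => mem_enum T x).
  by rewrite mem_iota /= add0n -cardE size_map.
have lt : (find a (iota 0 #|T|) < #|T|)%N.
  by rewrite -[X in (_ < X)%N](size_iota 0) -has_find.
have := nth_find 0 hasa; rewrite nth_iota // add0n => /existsP[t pt].
by exists t; rewrite // size_tuple.
Qed.

Lemma dist0P E u v : conn E u v ->
  reflect (u = v) (@dist (@Hypergraph T E) u v == 0).
Proof.
move=> c; apply: (iffP eqP) => [d0|->].
  have [s /andP[_ /eqP]] := dist_hpath c; rewrite d0.
  by case: s.
apply/eqP; rewrite -leqn0; apply: (@dist_le E v v [::]).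
by rewrite /hpath_between /hpath /= eqxx.
Qed.

Lemma dist_edge E e u v w : conn E v w -> e \in E -> u \in e -> v \in e ->
  (@dist (@Hypergraph T E) u w <= (@dist (@Hypergraph T E) v w).+1)%N.
Proof.
move=> c eE ue ve; have [s ps <-] := dist_hpath c.
have [s' [ps' sz]] := hpath_step eE ve ue ps; exact: leq_trans (dist_le ps') sz.
Qed.

Lemma dist_step E u w : (forall x y, conn E x y) -> u != w ->
  exists e v, [/\ e \in E, u \in e, v \in e &
    @dist (@Hypergraph T E) u w = (@dist (@Hypergraph T E) v w).+1].
Proof.
move=> c uw; have [[|[e v] s] ps sz] := dist_hpath (c u w).
  by case/andP: ps uw => _ /=  ->.
case/andP: ps => /and3P[/= /and4P[eE ue ve ws] /andP[_ us] /andP[_ us']] ls.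
exists e, v; split=> //; apply/eqP; rewrite eqn_leq (dist_edge _ eE) //=.
rewrite -sz ltnS; apply: (@dist_le E v w s).
by rewrite /hpath_between ls andbT; apply/and3P.
Qed.

End SupertreeHypertree.

(** * Rooted trees and edge counting *)

(** These properties of the distance to [v0] replace paths in all rooted arguments: descents exist,
    and heights within an edge differ by at most one. *)
Definition height_fun (T : finType) (E : {set {set T}}) (v0 : T) (h : T -> nat) :
    Prop :=
  [/\ forall v, (h v == 0) = (v == v0),
      forall v, v != v0 -> exists e w, [/\ e \in E, v \in e, w \in e & h v = (h w).+1]
    & forall e v w, e \in E -> v \in e -> w \in e -> (h v <= (h w).+1)%N].

Lemma height_height_fun (T : finType) (E : {set {set T}}) (v0 : T) :
  (forall x y, conn E x y) -> height_fun E v0 (@height (@Hypergraph T E) v0).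
Proof.
move=> c; split=> [v|v|e v w eE ve we].
- by apply/(dist0P (c v v0))/eqP.
- exact: dist_step.
- exact: (dist_edge (c w v0) eE ve we).
Qed.

Section Rooted.
Variables (T : finType) (E : {set {set T}}) (v0 : T) (h : T -> nat).
Hypothesis hE : height_fun E v0 h.
Implicit Types (e : {set T}) (x y z u v : T).

Let h_eq0 v : (h v == 0) = (v == v0). Proof. by case: hE. Qed.

Let h_step v : v != v0 ->
  exists e w, [/\ e \in E, v \in e, w \in e & h v = (h w).+1].
Proof. by case: hE => _ H _; exact: H. Qed.

Let h_edge e v w : e \in E -> v \in e -> w \in e -> (h v <= (h w).+1)%N.
Proof. by case: hE => _ _; exact. Qed.

(** Each step of a descent from [x] to the root ends strictly below all of [e], so it does not go
    through [e]. *)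
Lemma conn_low e x : (forall z, z \in e -> (h x <= h z)%N) -> conn (E :\ e) x v0.
Proof.
have [n] := ubnP (h x); elim: n x => // n IH x; rewrite ltnS => hn low.
have [->|xv] := eqVneq x v0; first exact: connxx.
have [e' [w [e'E xe we hx]]] := h_step xv.
have e'e : e' != e.
  by apply: contraTneq we => ->; apply/negP => /low; rewrite hx ltnn.
apply: conn_trans (_ : conn _ x w) _.
  by apply: (conn_edge (e := e')) => //; rewrite !inE e'e.
apply: IH => [|z /low]; first by rewrite -ltnS -hx.
by rewrite hx; apply: leq_trans.
Qed.

Lemma conn_low1 e x : x \notin e -> (forall z, z \in e -> (h x <= (h z).+1)%N) ->
  conn (E :\ e) x v0.
Proof.
move=> xe low; have [->|xv] := eqVneq x v0; first exact: connxx.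
have [e' [w [e'E xe' we hx]]] := h_step xv.
have e'e : e' != e by apply: contraNneq xe => <-.
apply: conn_trans (_ : conn _ x w) _.
  by apply: (conn_edge (e := e')) => //; rewrite !inE e'e.
by apply: conn_low => z /low; rewrite hx.
Qed.

Definition top e : T :=
  odflt v0 [pick x in e | [forall y in e, (h x <= h y)%N]].

Lemma topP e : e != set0 -> top e \in e /\ forall y, y \in e -> (h (top e) <= h y)%N.
Proof.
move=> /set0Pn[x xe]; rewrite /top; case: pickP => [y /andP[ye /forall_inP]|] //=.
pose z := [arg min_(z < x in e) h z].
have : z \in e /\ forall y, y \in e -> (h z <= h y)%N.
  by rewrite /z; case: arg_minnP.
by case=> ze zm /(_ z); rewrite ze /= => /forall_inP[].
Qed.

(** In a forest a non-root vertex has exactly one such edge, the one towards the root; the default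
    [set0] serves the root. *)
Definition pedge v : {set T} :=
  odflt set0 [pick e in E | (v \in e) && (top e != v)].

Definition parent v : T := top (pedge v).

Lemma pedgeP v : v != v0 -> [/\ pedge v \in E, v \in pedge v & parent v != v].
Proof.
move=> vv; rewrite /parent /pedge; case: pickP => [e /and3P[] //|/=].
have [e [w [eE ve we hv]]] := h_step vv; move/(_ e); rewrite eE ve /=.
have e0 : e != set0 by apply/set0Pn; exists v.
have [_ /(_ w we)] := topP e0.
by move=> + /negbFE/eqP te; rewrite te hv ltnn.
Qed.

(** Charge every non-root vertex to its parent edge. The top of an edge is never charged to that
    edge. In a forest the charging is exact, which gives [card_forest]. *)
Lemma card_le_edges : (#|T| <= (\sum_(e in E) #|e|.-1).+1)%N.
Proof.
rewrite -cardsT (cardsD1 v0) inE ltnS.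
rewrite -sum1_card (partition_big pedge (mem E)) /=; last first.
  by move=> v; rewrite !inE andbT => /pedgeP[].
apply: leq_sum => e eE; have [->|e0] := eqVneq e set0.
  rewrite big1 // => v /andP[]; rewrite !inE andbT => /pedgeP[_ vp _] /eqP pe.
  by rewrite pe inE in vp.
have [te _] := topP e0; rewrite (cardsD1 (top e) e) te /= -sum1_card.
rewrite [X in (X <= _)%N]big_mkcond [X in (_ <= X)%N]big_mkcond leq_sum // => v _.
case: ifP => // /andP[]; rewrite !inE andbT => /pedgeP[_ vp pv] /eqP pe.
by move: vp pv; rewrite /parent pe eq_sym => -> ->.
Qed.

Section ForestRoot.
Hypothesis fE : forest E.
Hypothesis E0 : set0 \notin E.

Let En0 e : e \in E -> e != set0. Proof. by apply: contraTneq => ->. Qed.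

Lemma top_in e : e \in E -> top e \in e.
Proof. by move=> /En0/topP[]. Qed.

Lemma top_le e y : e \in E -> y \in e -> (h (top e) <= h y)%N.
Proof. by move=> /En0/topP[_]; exact. Qed.

Lemma conn_top e : e \in E -> conn (E :\ e) (top e) v0.
Proof. by move=> eE; apply: conn_low => z; exact: top_le. Qed.

(** A second vertex at the height of the top would also descend to the root outside [e], which
    connects two vertices of [e] without [e]. *)
Lemma top_lt e y : e \in E -> y \in e -> y != top e -> h y = (h (top e)).+1.
Proof.
move=> eE ye yt; apply/eqP; rewrite eqn_leq (h_edge eE) ?top_in //=.
rewrite ltn_neqAle top_le // andbT; apply: contraNneq yt => hy.
apply/eqP; apply: (fE eE) => //; first exact: top_in.
apply: conn_trans (_ : conn _ v0 _); last by rewrite conn_sym conn_top.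
by apply: conn_low => z ze; rewrite -hy top_le.
Qed.

(** Otherwise [v] reaches the root without [e], through [e'] and its top; [top e] also reaches it
    without [e]. *)
Lemma nontop_uniq e e' v : e \in E -> e' \in E -> v \in e -> v \in e' ->
  v != top e -> v != top e' -> e = e'.
Proof.
move=> eE e'E ve ve' vt vt'; apply/eqP/negPn/negP => ee'.
case/eqP: (vt); apply: (fE eE) => //; first exact: top_in.
apply: conn_trans (_ : conn _ (top e') _).
  by apply: (conn_edge (e := e')) => //; rewrite ?top_in // !inE eq_sym ee'.
apply: conn_trans (_ : conn _ v0 _); last by rewrite conn_sym conn_top.
apply: conn_low => z ze; rewrite -ltnS -(top_lt e'E ve' vt') (top_lt eE ve vt).
by rewrite ltnS top_le.
Qed.

Lemma pedge_uniq e v : e \in E -> v \in e -> v != top e -> v != v0 /\ e = pedge v.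
Proof.
move=> eE ve vt; have vv : v != v0.
  by apply: contraTneq (leqnn (h v)) => /eqP; rewrite -h_eq0 (top_lt eE).
split=> //; have [pE vp pv] := pedgeP vv.
by apply: (nontop_uniq eE pE ve vp vt); rewrite eq_sym.
Qed.

Lemma h_parent v : v != v0 -> h v = (h (parent v)).+1.
Proof. by move=> /pedgeP[pE vp pv]; apply: top_lt => //; rewrite eq_sym. Qed.

Lemma parent_in v : v != v0 -> parent v \in pedge v.
Proof. by move=> /pedgeP[pE _ _]; exact: top_in. Qed.

Lemma is_parentE p c : (h c == (h p).+1) && [exists e in E, (p \in e) && (c \in e)] =
  (c != v0) && (p == parent c).
Proof.
apply/andP/andP => [[/eqP hc /exists_inP[e eE /andP[pe ce]]]|[cv /eqP ->]].
  have ct : c != top e.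
    apply: contraTneq (leqnn (h c)) => ct.
    by rewrite -ltnNge {2}hc ltnS {1}ct top_le.
  have [cv ee] := pedge_uniq eE ce ct; split=> //; rewrite /parent -ee.
  apply: contraT => pt; have := top_lt eE ce ct; rewrite hc.
  by rewrite (top_lt eE pe pt) => -[] /eqP; rewrite gtn_eqF.
split; first by rewrite -h_parent.
apply/exists_inP; have [pE vp pv] := pedgeP cv.
by exists (pedge c) => //; rewrite vp parent_in.
Qed.

Lemma card_forest : #|T| = (\sum_(e in E) #|e|.-1).+1.
Proof.
rewrite -cardsT (cardsD1 v0) inE add1n; congr _.+1.
rewrite -sum1_card (partition_big pedge (mem E)) /=; last first.
  by move=> v; rewrite !inE andbT => /pedgeP[].
apply: eq_bigr => e eE; have te := top_in eE.
rewrite (cardsD1 (top e) e) te /= -sum1_card; apply: eq_bigl => v.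
rewrite !inE andbT; apply/andP/andP => [[vv /eqP pe]|[vt ve]].
  by have [_ vp pv] := pedgeP vv; rewrite -pe eq_sym.
by have [vv <-] := pedge_uniq eE ve vt.
Qed.

End ForestRoot.
End Rooted.

(** * Hypertrees recognised by counting edges *)

Section EdgeMap.
Variables (T : finType) (k : nat).
Hypothesis k2 : (2 <= k)%N.
Implicit Types (E : {set {set T}}).

Lemma conn_card E : (forall x y, conn E x y) ->
  (#|T| <= (\sum_(e in E) #|e|.-1).+1)%N.
Proof.
move=> c; have [/card0_eq T0|/card_gt0P[v0 _]] := posnP #|T|.
  by rewrite (eq_card0 T0).
exact: (card_le_edges (height_height_fun v0 c)).
Qed.

Lemma uniform_neq0 E : (forall e, e \in E -> #|e| = k) -> set0 \notin E.
Proof. by move=> uE; apply/negP => /uE; rewrite cards0; case: k k2. Qed.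

Lemma hypertree_card E (v0 : T) : hypertree k E -> #|T| = (#|E| * k.-1).+1.
Proof.
case=> uE c fE.
rewrite (card_forest (height_height_fun v0 c) fE (uniform_neq0 uE)); congr _.+1.
by rewrite (eq_bigr (fun=> k.-1)) ?sum_nat_const // => e /uE ->.
Qed.

(** If [x] and [y] in [e] stay connected without [e], then removing [x] from [e] keeps the
    hypergraph connected but makes the total of [#|e|.-1] too small for [conn_card]. *)
Lemma card_hypertree E : (forall e, e \in E -> #|e| = k) ->
  (forall x y, conn E x y) -> (#|E| * k.-1 < #|T|)%N -> hypertree k E.
Proof.
move=> uE c lt; split=> // e x y eE xe ye cxy; apply/eqP/negPn/negP => xy.
pose E' := (e :\ x) |: (E :\ e).
have c' a b : conn E' a b.
  have sub : E :\ e \subset E' by exact: subsetUr.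
  have xz z : z \in e -> conn E' x z.
    move=> ze; have [->|zx] := eqVneq z x; first exact: connxx.
    apply: conn_trans (conn_subset sub cxy) _.
    apply: (conn_edge (e := e :\ x)); rewrite ?setU11 // !inE ?zx //.
    by rewrite eq_sym xy.
  apply: conn_mono (c a b) => g a' b' gE ag bg.
  have [ge|ge] := eqVneq g e.
    rewrite ge in ag bg; apply: conn_trans (xz _ bg).
    by rewrite conn_sym; exact: xz.
  by apply: (conn_edge (e := g)) => //; rewrite !inE ge gE orbT.
have := conn_card c'; rewrite leqNgt => /negP[]; apply: leq_ltn_trans lt.
have -> : (#|E| * k.-1 = k.-1 + #|E :\ e| * k.-1)%N.
  by rewrite (cardsD1 e) eE mulnDl mul1n.
have ce : #|e :\ x| = k.-1 by rewrite -(uE e eE) (cardsD1 x e) xe.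
have k1 : (0 < k.-1)%N by case: k k2 => [|[]].
have sE : \sum_(g in E :\ e) #|g|.-1 = (#|E :\ e| * k.-1)%N.
  rewrite (eq_bigr (fun=> k.-1)) ?sum_nat_const // => g.
  by rewrite inE => /andP[_ /uE ->].
have [i|i] := boolP (e :\ x \in E :\ e).
  rewrite /E' (setUidPr _) ?sub1set // sE -[X in (X <= _)%N]add1n leq_add2r //.
by rewrite big_setU1 //= ce sE -addSn prednK.
Qed.

(** The image has at most as many edges as [E], so connectivity makes it a hypertree; the exact edge
    count then forces injectivity. *)
Lemma edge_map_hypertree E (phi : {set T} -> {set T}) :
  hypertree k E -> (forall e, e \in E -> #|phi e| = k) ->
  (forall e x y, e \in E -> x \in e -> y \in e -> conn (phi @: E) x y) ->
  hypertree k (phi @: E) /\ {in E &, injective phi}.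
Proof.
move=> tE cphi conphi; have [uE c fE] := tE.
have c' x y : conn (phi @: E) x y.
  by apply: conn_mono (c x y) => e a b; exact: conphi.
have u' e : e \in phi @: E -> #|e| = k by case/imsetP=> g gE ->; exact: cphi.
have [/card0_eq T0|/card_gt0P[v0 _]] := posnP #|T|.
  have E0 e : e \in E -> False.
    move=> eE; have := uE e eE; rewrite eq_card0 => [k0|x].
      by move: k2; rewrite -k0.
    by have := T0 x.
  by split=> [|e e' /E0 //]; split=> // e x; have := T0 x.
have k1 : (0 < k.-1)%N by case: k k2 => [|[]].
have cT := hypertree_card v0 tE.
have lt : (#|phi @: E| * k.-1 < #|T|)%N.
  by rewrite cT ltnS leq_mul2r leq_imset_card orbT.
split; first exact: card_hypertree.
apply/imset_injP; rewrite eqn_leq leq_imset_card /=.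
have := hypertree_card v0 (card_hypertree u' c' lt).
by rewrite cT => -[/eqP]; rewrite eqn_pmul2r // => /eqP ->.
Qed.

End EdgeMap.

(** * Moving vertices between edges *)

Section EdgeReplacement.
Variables (T : finType).
Implicit Types (E S : {set {set T}}) (e : {set T}) (x y z u v b c : T).

Definition replace b c e : {set T} := c |: (e :\ b).

Lemma in_replace b c e x : (x \in replace b c e) = (x == c) || (x != b) && (x \in e).
Proof. by rewrite !inE. Qed.

Lemma card_replace b c e : b \in e -> c \notin e -> #|replace b c e| = #|e|.
Proof.
by move=> be ce; rewrite /replace cardsU1 !inE (negPf ce) andbF (cardsD1 b e) be.
Qed.

Definition shift_edges S u v e := if e \in S then replace u v e else e.

Definition swap_edges e1 e2 b c e :=
  if e == e1 then replace b c e1 else if e == e2 then replace c b e2 else e.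

Variables (k : nat) (E : {set {set T}}).
Hypotheses (k2 : (2 <= k)%N) (tE : hypertree k E).

Lemma nonpath_notin u v e : u != v -> e \in E -> u \in e -> conn (E :\ e) u v ->
  v \notin e.
Proof.
have [_ _ fE] := tE; move=> uv eE ue c; apply: contra uv => ve; apply/eqP.
exact: (fE e).
Qed.

Lemma shift_hypertree S u v : u != v -> S \subset E ->
  (forall e, e \in S -> u \in e /\ conn (E :\ e) u v) ->
  hypertree k (shift_edges S u v @: E) /\ {in E &, injective (shift_edges S u v)}.
Proof.
have [uE c fE] := tE; move=> uv /subsetP SE Su.
have vS e : e \in S -> v \notin e.
  by move=> eS; have [ue ce] := Su _ eS; apply: (nonpath_notin uv _ ue ce); exact: SE.
apply: edge_map_hypertree => // [e eE|e x y eE xe ye].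
  rewrite /shift_edges; case: ifP => eS; last exact: uE.
  by rewrite card_replace ?vS ?uE //; have [] := Su _ eS.
have Hin g : g \in E -> shift_edges S u v g \in shift_edges S u v @: E.
  exact: imset_f.
(* The path from [u] to [v] uses none of the moved edges, so it survives, and every moved edge now
   hangs at [v]. *)
have Huv : conn (shift_edges S u v @: E) u v.
  apply: conn_mono (conn_drop_edges fE (subxx _) (c u v) Su) => g a b.
  rewrite inE => /andP[gS gE]; apply: conn_edge.
  by have := Hin _ gE; rewrite /shift_edges (negPf gS).
have He z : z \in e -> conn (shift_edges S u v @: E) z (if e \in S then v else x).
  move=> ze; have := Hin _ eE; rewrite /shift_edges; case: ifP => eS i.
    have [->//|zu] := eqVneq z u.
    by apply: (conn_edge i); rewrite in_replace ?zu ?ze ?eqxx ?orbT.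
  exact: (conn_edge i).
by apply: conn_trans (He _ xe) _; rewrite conn_sym; exact: He.
Qed.

Section Swap.
Variables (e1 e2 : {set T}) (b c x1 x2 : T).
Hypotheses (e1E : e1 \in E) (e2E : e2 \in E) (e12 : e1 != e2).
Hypotheses (be1 : b \in e1) (ce2 : c \in e2) (bc : b != c).
Hypotheses (x1e : x1 \in e1) (x2e : x2 \in e2).
Hypothesis x12 : conn (E :\ e1 :\ e2) x1 x2.
Hypothesis attach : (x1 == b) = (x2 == c).

Lemma swap_notin : (c \notin e1) * (b \notin e2).
Proof.
have [uE _ fE] := tE.
have x12_1 : conn (E :\ e1) x1 x2 by apply: conn_subset x12; exact: subD1set.
have x12_2 : conn (E :\ e2) x1 x2.
  by apply: conn_subset x12; exact: setSD (subD1set _ _).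
have e1E2 : e1 \in E :\ e2 by rewrite !inE e12.
have e2E1 : e2 \in E :\ e1 by rewrite !inE eq_sym e12.
split; apply/negP => i.
  have x2c : c = x2.
    by apply: (fE e2) => //; apply: conn_trans (conn_edge e1E2 i x1e) x12_2.
  have /eqP x1b : x1 == b by rewrite attach x2c.
  by case/eqP: bc; apply: (fE e1) => //; rewrite -x1b x2c.
have x1b : x1 = b.
  by apply: (fE e1) => //; apply: conn_trans x12_1 (conn_edge e2E1 x2e i).
have /eqP x2c : x2 == c by rewrite -attach x1b.
by case/eqP: bc; apply: (fE e2) => //; rewrite -x1b -x2c.
Qed.

(** [x1] and [x2] are the ends of the connection between the two edges, and [attach] asks that both
    or neither be exchanged. Exchanging only one of them would put both ends into one edge and close
    a cycle. *)
Lemma swap_hypertree : hypertree k (swap_edges e1 e2 b c @: E) /\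
  {in E &, injective (swap_edges e1 e2 b c)}.
Proof.
have [uE cE fE] := tE; have [ce1 be2] := swap_notin.
pose phi := swap_edges e1 e2 b c; rewrite -/phi.
have phi1 : phi e1 = replace b c e1 by rewrite /phi /swap_edges eqxx.
have phi2 : phi e2 = replace c b e2.
  by rewrite /phi /swap_edges eqxx eq_sym (negPf e12).
have phi0 e : e != e1 -> e != e2 -> phi e = e.
  by rewrite /phi /swap_edges => /negPf -> /negPf ->.
have Hin g : g \in E -> phi g \in phi @: E by exact: imset_f.
have i1 := Hin _ e1E; have i2 := Hin _ e2E; rewrite phi1 in i1; rewrite phi2 in i2.
have Hx : conn (phi @: E) x1 x2.
  apply: conn_mono x12 => e a a'; rewrite !inE => /and3P[ee2 ee1 eE].
  by apply: conn_edge; have := Hin _ eE; rewrite phi0.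
have z1 z : z \in e1 -> z != b -> z \in replace b c e1.
  by rewrite in_replace => -> ->; rewrite orbT.
have z2 z : z \in e2 -> z != c -> z \in replace c b e2.
  by rewrite in_replace => -> ->; rewrite orbT.
have zc : c \in replace b c e1 by rewrite in_replace eqxx.
have zb : b \in replace c b e2 by rewrite in_replace eqxx.
apply: edge_map_hypertree => // [e eE|e x y eE xe ye].
  have [->|ee1] := eqVneq e e1; first by rewrite phi1 card_replace ?uE.
  have [->|ee2] := eqVneq e e2; first by rewrite phi2 card_replace ?uE.
  by rewrite phi0 ?uE.
have [x1b|x1b] := eqVneq x1 b.
  have x2c : x2 = c by apply/eqP; rewrite -attach x1b.
  rewrite x1b x2c in Hx.
  have Z1 z : z \in e1 -> conn (phi @: E) z c.
    by move=> ze; have [->//|zb'] := eqVneq z b; exact: (conn_edge i1 (z1 _ ze zb') zc).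
  have Z2 z : z \in e2 -> conn (phi @: E) z b.
    move=> ze; have [->|zb'] := eqVneq z c; first by rewrite conn_sym.
    exact: (conn_edge i2 (z2 _ ze zb') zb).
  have [ee1|ee1] := eqVneq e e1.
    by rewrite ee1 in xe ye; apply: conn_trans (Z1 _ xe) _; rewrite conn_sym Z1.
  have [ee2|ee2] := eqVneq e e2.
    by rewrite ee2 in xe ye; apply: conn_trans (Z2 _ xe) _; rewrite conn_sym Z2.
  by apply: (conn_edge (Hin _ eE)); rewrite phi0.
have x2c : x2 != c by rewrite -attach.
have Z1 z : z \in e1 -> conn (phi @: E) z x1.
  move=> ze; have [->|zb'] := eqVneq z b.
    by apply: conn_trans (conn_edge i2 zb (z2 x2 x2e x2c)) _; rewrite conn_sym.
  exact: (conn_edge i1 (z1 _ ze zb') (z1 _ x1e x1b)).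
have Z2 z : z \in e2 -> conn (phi @: E) z x2.
  move=> ze; have [->|zb'] := eqVneq z c.
    by apply: conn_trans Hx; exact: (conn_edge i1 zc (z1 x1 x1e x1b)).
  exact: (conn_edge i2 (z2 _ ze zb') (z2 _ x2e x2c)).
have [ee1|ee1] := eqVneq e e1.
  by rewrite ee1 in xe ye; apply: conn_trans (Z1 _ xe) _; rewrite conn_sym Z1.
have [ee2|ee2] := eqVneq e e2.
  by rewrite ee2 in xe ye; apply: conn_trans (Z2 _ xe) _; rewrite conn_sym Z2.
by apply: (conn_edge (Hin _ eE)); rewrite phi0.
Qed.

End Swap.
End EdgeReplacement.

(** * Change of the energy and of the Laplacian under exchanges *)

Section EdgeFunctionals.
Local Open Scope ring_scope.
Variables (R : realType) (T : finType) (k : nat).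
Implicit Types (E S : {set {set T}}) (e : {set T}) (f : T -> R).

Definition esum f e : R := \sum_(x in e) f x.

(* [k - 1] times the Dirichlet energy of [f] and its Laplacian at [v]. *)
Definition energy E f : R :=
  k%:R * \sum_v (degree E v)%:R * f v ^+ 2 - \sum_(e in E) esum f e ^+ 2.

Definition lap E f v : R :=
  k%:R * (degree E v)%:R * f v - \sum_(e in E | v \in e) esum f e.

Lemma degree_sum E v : degree E v = (\sum_(e in E) (v \in e))%N.
Proof.
rewrite /degree -sum1_card (eq_bigl (fun e => (e \in E) && (v \in e))); last first.
  by move=> e; rewrite inE.
by rewrite big_mkcondr; apply: eq_bigr => e _; case: (v \in e).
Qed.

Lemma degree_imset E (phi : {set T} -> {set T}) v : {in E &, injective phi} ->
  degree (phi @: E) v = (\sum_(e in E) (v \in phi e))%N.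
Proof. by move=> inj; rewrite degree_sum big_imset. Qed.

Lemma sum_imset_mem E (phi : {set T} -> {set T}) v f :
  {in E &, injective phi} ->
  \sum_(e in phi @: E | v \in e) esum f e =
  \sum_(e in E | v \in phi e) esum f (phi e).
Proof.
move=> inj; rewrite big_mkcondr big_imset //= [RHS]big_mkcondr.
by apply: eq_bigr => e _.
Qed.

Lemma esum_replace f b c e : b \in e -> c \notin e ->
  esum f (replace b c e) = esum f e + (f c - f b).
Proof.
move=> be ce; rewrite /esum (big_setD1 b be) /= /replace big_setU1 /=; first by ring.
by rewrite !inE (negPf ce) andbF.
Qed.

Variable E : {set {set T}}.
Hypotheses (k2 : (2 <= k)%N) (tE : hypertree k E).

Section SwapFunctionals.
Variables (e1 e2 : {set T}) (b c x1 x2 : T).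
Hypotheses (e1E : e1 \in E) (e2E : e2 \in E) (e12 : e1 != e2).
Hypotheses (be1 : b \in e1) (ce2 : c \in e2) (bc : b != c).
Hypotheses (x1e : x1 \in e1) (x2e : x2 \in e2).
Hypothesis x12 : conn (E :\ e1 :\ e2) x1 x2.
Hypothesis attach : (x1 == b) = (x2 == c).
Let phi := swap_edges e1 e2 b c.

Let split2 (V : nmodType) (F : {set T} -> V) :
  \sum_(e in E) F e = F e1 + (F e2 + \sum_(e in E | (e != e1) && (e != e2)) F e).
Proof.
rewrite (bigD1 e1) //= (bigD1 e2) /=; last by rewrite e2E eq_sym.
by congr (_ + (_ + _)); apply: eq_bigl => e; rewrite andbA.
Qed.

Let notin := swap_notin tE e1E e2E e12 be1 ce2 bc x1e x2e x12 attach.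
Let inj := (swap_hypertree k2 tE e1E e2E e12 be1 ce2 bc x1e x2e x12 attach).2.

Let phi1 : phi e1 = replace b c e1. Proof. by rewrite /phi /swap_edges eqxx. Qed.
Let phi2 : phi e2 = replace c b e2.
Proof. by rewrite /phi /swap_edges eqxx eq_sym (negPf e12). Qed.
Let phi0 e : e != e1 -> e != e2 -> phi e = e.
Proof. by rewrite /phi /swap_edges => /negPf -> /negPf ->. Qed.

Lemma degree_swap v : degree (phi @: E) v = degree E v.
Proof.
have [ce1 be2] := notin.
rewrite degree_imset // degree_sum !(@split2 nat) phi1 phi2.
rewrite !in_replace !addrA; congr (_ + _)%N; last first.
  by apply: eq_bigr => e /and3P[_ ee1 ee2]; rewrite phi0.
have [->|vb] := eqVneq v b; first by rewrite be1 (negPf be2) (negPf bc).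
by have [->|vc] := eqVneq v c; rewrite ?ce2 ?(negPf ce1) //= andbF.
Qed.

Lemma energy_swap f : energy (phi @: E) f = energy E f -
  2 * (f c - f b) * (esum f e1 - esum f e2 + (f c - f b)).
Proof.
have [ce1 be2] := notin; rewrite /energy.
under eq_bigr do rewrite degree_swap.
rewrite big_imset //= !(@split2 R) phi1 phi2 !esum_replace //.
under [X in _ - (_ + (_ + X))]eq_bigr => e /and3P[_ ee1 ee2] do rewrite phi0 //.
by ring.
Qed.

(** The increment is the last factor of the energy change in [energy_swap]. If [f b = f c] the
    energy is kept, and for an eigenfunction of both trees this factor has to vanish. *)
Lemma lap_swap f : lap (phi @: E) f b = lap E f b +
  (esum f e1 - esum f e2 + (f c - f b)).
Proof.
have [ce1 be2] := notin; rewrite /lap degree_swap sum_imset_mem //.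
rewrite !big_mkcondr !(@split2 R) /= phi1 phi2 !in_replace eqxx be1 (negPf be2).
rewrite (negPf bc) /= esum_replace //.
under [X in _ - (_ + (_ + X))]eq_bigr => e /and3P[_ ee1 ee2] do rewrite phi0 //.
by ring.
Qed.

End SwapFunctionals.

Section ShiftFunctionals.
Variables (S : {set {set T}}) (u v : T).
Hypotheses (uv : u != v) (SE : S \subset E).
Hypothesis Su : forall e, e \in S -> u \in e /\ conn (E :\ e) u v.
Let phi := shift_edges S u v.

Let vS e : e \in S -> v \notin e.
Proof.
move=> eS; have [ue ce] := Su eS; apply: (nonpath_notin tE uv _ ue ce).
exact: (subsetP SE).
Qed.
Let inj := (shift_hypertree k2 tE uv SE Su).2.

Let splitS (V : nmodType) (F : {set T} -> V) :
  \sum_(e in E) F e = \sum_(e in S) F e + \sum_(e in E :\: S) F e.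
Proof. by rewrite (big_setID S) /= (setIidPr SE). Qed.

Let phiS e : e \in S -> phi e = replace u v e.
Proof. by rewrite /phi /shift_edges => ->. Qed.
Let phiN e : e \in E :\: S -> phi e = e.
Proof. by rewrite /phi /shift_edges inE => /andP[/negPf ->]. Qed.

Lemma degree_shift w : (degree (phi @: E) w + (w == u) * #|S| =
  degree E w + (w == v) * #|S|)%N.
Proof.
rewrite degree_imset // degree_sum !(@splitS nat).
rewrite [X in (_ + X + _)%N](eq_bigr (fun e => (w \in e) : nat)); last first.
  by move=> e /phiN ->.
rewrite [X in (X + _ + _)%N]
  (eq_bigr (fun e => ((w == v) || (w != u) && (w \in e)) : nat)); last first.
  by move=> e /phiS ->; rewrite in_replace.
rewrite addnAC [in RHS]addnAC; congr (_ + _)%N.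
have [->|wv] := eqVneq w v.
  rewrite eq_sym (negPf uv) mul0n mul1n addn0 sum1_card.
  by rewrite [X in (X + _)%N]big1 // => e /vS /negPf ->.
rewrite mul0n addn0; have [->|wu] := eqVneq w u; last by rewrite addn0.
rewrite big1 // mul1n add0n -sum1_card; apply: eq_bigr => e /Su[-> _] //.
Qed.

Lemma energy_shift f : energy (phi @: E) f = energy E f +
  k%:R * #|S|%:R * (f v ^+ 2 - f u ^+ 2) -
  \sum_(e in S) ((esum f e + (f v - f u)) ^+ 2 - esum f e ^+ 2).
Proof.
have dE w : (degree (phi @: E) w)%:R = (degree E w)%:R +
    #|S|%:R * ((w == v)%:R - (w == u)%:R) :> R.
  have := congr1 (fun n => n%:R : R) (degree_shift w).
  by rewrite !natrD !natrM => H; apply: (addIr ((w == u)%:R * #|S|%:R)); rewrite H; ring.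
rewrite /energy; have -> : \sum_w (degree (phi @: E) w)%:R * f w ^+ 2 =
    \sum_w (degree E w)%:R * f w ^+ 2 + #|S|%:R * (f v ^+ 2 - f u ^+ 2).
  have sumd x : \sum_w (w == x)%:R * f w ^+ 2 = f x ^+ 2.
    rewrite (bigD1 x) //= eqxx mul1r big1 ?addr0 // => w /negPf ->.
    by rewrite mul0r.
  rewrite -(sumd v) -(sumd u) -sumrB mulr_sumr -big_split /=.
  by apply: eq_bigr => w _; rewrite dE; ring.
rewrite big_imset //= !(@splitS R) sumrB.
rewrite [X in _ - (X + _)](eq_bigr (fun e => (esum f e + (f v - f u)) ^+ 2)); last first.
  by move=> e eS; rewrite phiS // esum_replace ?vS //; have [] := Su eS.
rewrite [X in _ - (_ + X)](eq_bigr (fun e => esum f e ^+ 2)); last first.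
  by move=> e /phiN ->.
by ring.
Qed.

Lemma lap_shift f : lap (phi @: E) f u = lap E f u -
  k%:R * #|S|%:R * f u + \sum_(e in S) esum f e.
Proof.
have dE : (degree E u)%:R = (degree (phi @: E) u)%:R + #|S|%:R :> R.
  have := degree_shift u; rewrite eqxx (negPf uv) mul1n mul0n addn0 => <-.
  by rewrite natrD.
rewrite /lap dE sum_imset_mem // !big_mkcondr !(@splitS R).
rewrite [X in _ - (X + _)]big1 => [|e eS]; last first.
  by rewrite phiS // in_replace eqxx (negPf uv).
rewrite [X in _ - (_ + X)](eq_bigr (fun e => if u \in e then esum f e else 0)); last first.
  by move=> e /phiN ->.
rewrite [X in _ - _ = _ - (X + _) - _ + _](eq_bigr (esum f)); last first.
  by move=> e /Su[-> _].
by ring.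
Qed.

End ShiftFunctionals.
End EdgeFunctionals.

(** * Exchange inequalities for an energy minimizer *)

Local Open Scope ring_scope.

Lemma subset_of_card (T : finType) (A : {set T}) n : (n <= #|A|)%N ->
  exists2 B : {set T}, B \subset A & #|B| = n.
Proof.
move=> nA; exists [set x in take n (enum A)].
  by apply/subsetP => x; rewrite inE => /mem_take; rewrite mem_enum.
rewrite cardsE; have /card_uniqP -> : uniq (take n (enum A)).
  exact/take_uniq/enum_uniq.
by rewrite size_takel // -cardE.
Qed.

Section Optimal.
Variables (R : realType) (T : finType) (k : nat).
Implicit Types (E : {set {set T}}) (e g : {set T}) (u v b c p q : T).

(** The edges at [u] that do not lead towards [v]: the branches of [u] that can be moved to [v]
    without breaking the path between them. *)
Definition nonpath E u v e := [&& e \in E, u \in e & conn (E :\ e) u v].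

(* [opt_min] also records that a competitor attaining the minimum has [f] as an
   eigenfunction for the same eigenvalue; this settles all ties. *)
Record optimal E (f : T -> R) (mu : R) : Prop := Optimal {
  opt_tree : hypertree k E;
  opt_ge0 : forall v, 0 <= f v;
  opt_eq0 : forall v, (f v == 0) = (degree E v == 1%N);
  opt_mu : E != set0 -> 0 < mu;
  opt_lap : forall v, degree E v != 1%N -> lap k E f v = mu * f v;
  opt_min : forall E', hypertree k E' ->
    perm_eq [seq degree E' v | v <- enum T] [seq degree E v | v <- enum T] ->
    (forall v, (degree E' v == 1%N) = (degree E v == 1%N)) ->
    energy k E f <= energy k E' f /\
    (energy k E' f = energy k E f ->
       forall v, degree E v != 1%N -> lap k E' f v = mu * f v)
}.

Variables (E : {set {set T}}) (f : T -> R) (mu : R).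
Hypotheses (k2 : (2 <= k)%N) (oE : optimal E f mu).

Let tE := opt_tree oE.
Let fE : forest E. Proof. by case: tE. Qed.
Let cE x y : conn E x y. Proof. by case: tE. Qed.
Let uE e : e \in E -> #|e| = k. Proof. by case: tE => H _ _; exact: H. Qed.

Lemma opt_gt0 v : degree E v != 1%N -> 0 < f v.
Proof. by rewrite -(opt_eq0 oE) lt_neqAle eq_sym (opt_ge0 oE) andbT => ->. Qed.

Lemma edge_other e v : e \in E -> v \in e -> exists2 c, c \in e & c != v.
Proof.
move=> eE ve; have : (0 < #|e :\ v|)%N.
  by have := k2; rewrite -(uE eE) (cardsD1 v) ve.
by move=> /card_gt0P[c]; rewrite !inE => /andP[? ?]; exists c.
Qed.

Lemma pathE u v : u != v -> exists g, [/\ g \in E, u \in g,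
  forall e, nonpath E u v e = [&& e \in E, u \in e & e != g] &
  degree E u = #|[set e | nonpath E u v e]|.+1].
Proof.
move=> uv; have [g [gE ug ng H]] := path_edge fE (cE u v) uv.
have E1 e : nonpath E u v e = [&& e \in E, u \in e & e != g].
  rewrite /nonpath; have [eE /=|//] := boolP (e \in E).
  have [ue /=|//] := boolP (u \in e).
  by apply/idP/idP => [|eg]; [apply: contraTneq => ->|exact: H].
exists g; split=> //; rewrite /degree (cardsD1 g) inE gE ug add1n; congr _.+1.
by apply: eq_card => e; rewrite !inE E1 andbC andbA.
Qed.

Lemma nonpath_degree u v e : u != v -> nonpath E u v e -> degree E u != 1%N.
Proof.
move=> uv ne; have [g [_ _ _ ->]] := pathE uv.
by rewrite eqSS cards_eq0; apply/set0Pn; exists e; rewrite inE.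
Qed.

Lemma nonpath_exists u v : u != v -> degree E u != 1%N ->
  exists e, nonpath E u v e.
Proof.
move=> uv; have [g [_ _ _ ->]] := pathE uv.
by rewrite eqSS cards_eq0 => /set0Pn[e]; rewrite inE; exists e.
Qed.

Lemma path_sum (F : {set T} -> R) u v g : u != v -> g \in E -> u \in g ->
  ~~ conn (E :\ g) u v ->
  \sum_(e in E | u \in e) F e = F g + \sum_(e | nonpath E u v e) F e.
Proof.
move=> uv gE ug ng; have [g' [_ _ npE _]] := pathE uv.
have gg : g = g'.
  by apply/eqP; apply: contraNT ng => gg; have := npE g; rewrite /nonpath gE ug gg.
rewrite (bigD1 g) /=; last by rewrite gE.
by congr (_ + _); apply: eq_bigl => e; rewrite npE -gg andbA.
Qed.

Section SwapOptimal.
Variables (e1 e2 : {set T}) (b c x1 x2 : T).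
Hypotheses (e1E : e1 \in E) (e2E : e2 \in E) (e12 : e1 != e2).
Hypotheses (be1 : b \in e1) (ce2 : c \in e2) (bc : b != c).
Hypotheses (x1e : x1 \in e1) (x2e : x2 \in e2).
Hypothesis x12 : conn (E :\ e1 :\ e2) x1 x2.
Hypothesis attach : (x1 == b) = (x2 == c).

Lemma opt_swap : (f c - f b) * (esum f e1 - esum f e2 + (f c - f b)) <= 0 /\
  ((f c - f b) * (esum f e1 - esum f e2 + (f c - f b)) = 0 ->
   degree E b != 1%N -> esum f e1 - esum f e2 + (f c - f b) = 0).
Proof.
pose E' := swap_edges e1 e2 b c @: E.
have dE v : degree E' v = degree E v
  by exact: (degree_swap k2 tE e1E e2E e12 be1 ce2 bc x1e x2e x12 attach).
have [tE' _] : hypertree k E' /\ _ :=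
  swap_hypertree k2 tE e1E e2E e12 be1 ce2 bc x1e x2e x12 attach.
have [||le eq] := opt_min oE tE'.
- by rewrite (eq_map dE).
- by move=> v; rewrite dE.
have eW : energy k E' f = _ := energy_swap k2 tE e1E e2E e12 be1 ce2 bc x1e x2e x12 attach f.
have lW : lap k E' f b = _ := lap_swap k2 tE e1E e2E e12 be1 ce2 bc x1e x2e x12 attach f.
split; first by move: le; rewrite eW; lra.
move=> z db; have := eq _ _ db; rewrite lW (opt_lap oE db) => H.
have {}H : energy k E' f = energy k E f -> esum f e1 - esum f e2 + (f c - f b) = 0.
  by move=> /H; lra.
by apply: H; rewrite eW -mulrA z mulr0 subr0.
Qed.

End SwapOptimal.

Section ShiftOptimal.
Variables (S : {set {set T}}) (u v : T).
Hypotheses (uv : u != v) (du : degree E u != 1%N) (dv : degree E v != 1%N).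
Hypothesis Su : forall e, e \in S -> nonpath E u v e.
Hypothesis cS : (#|S| + degree E v = degree E u)%N.

Lemma opt_shift :
  let D := k%:R * #|S|%:R * (f v ^+ 2 - f u ^+ 2) -
    \sum_(e in S) ((esum f e + (f v - f u)) ^+ 2 - esum f e ^+ 2) in
  0 <= D /\ (D = 0 -> k%:R * #|S|%:R * f u = \sum_(e in S) esum f e).
Proof.
move=> D; pose E' := shift_edges S u v @: E.
have SE : S \subset E by apply/subsetP => e /Su/and3P[].
have Su' e : e \in S -> u \in e /\ conn (E :\ e) u v by move=> /Su/and3P[].
have [tE' _] : hypertree k E' /\ _ := shift_hypertree k2 tE uv SE Su'.
(* By [cS] exactly the surplus of degree moves, so [u] and [v] trade degrees and the degree sequence
   is kept. *)
have dE w : degree E' w = degree E (tperm u v w).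
  have : (degree E' w + (w == u) * #|S| = degree E w + (w == v) * #|S|)%N.
    exact: (degree_shift k2 tE uv SE Su').
  have [->|wu] := eqVneq w u.
    by rewrite (negPf uv) tpermL mul1n mul0n; lia.
  have [->|wv] := eqVneq w v; first by rewrite tpermR mul1n mul0n; lia.
  by rewrite !mul0n !addn0 tpermD // eq_sym.
have [||le eq] := opt_min oE tE'.
- rewrite (eq_map dE) (map_comp (degree E)); apply: perm_map; apply: uniq_perm.
  + by rewrite map_inj_uniq ?enum_uniq //; exact: perm_inj.
  + exact: enum_uniq.
  + move=> w; rewrite mem_enum; apply/mapP; exists (tperm u v w).
      by rewrite mem_enum.
    by rewrite tpermK.
- move=> w; rewrite dE; case: tpermP => [->|->|//].
    by rewrite (negPf du) (negPf dv).
  by rewrite (negPf du) (negPf dv).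
have eW : energy k E' f = _ := energy_shift k2 tE uv SE Su' f.
have lW : lap k E' f u = _ := lap_shift k2 tE uv SE Su' f.
split; first by move: le; rewrite eW /D; lra.
move=> D0; have := eq _ _ du; rewrite lW (opt_lap oE du) => H.
have {}H : energy k E' f = energy k E f ->
    k%:R * #|S|%:R * f u = \sum_(e in S) esum f e by move=> /H; lra.
by apply: H; rewrite eW; move: D0; rewrite /D; lra.
Qed.

End ShiftOptimal.

Lemma nonpath_pair u v e1 e2 : u != v -> nonpath E u v e1 -> nonpath E v u e2 ->
  e1 != e2 /\ conn (E :\ e1 :\ e2) u v.
Proof.
move=> uv /and3P[e1E ue1 c1] /and3P[e2E ve2 c2]; split.
  apply: contraTneq ve2 => <-; exact: (nonpath_notin tE uv).
rewrite conn_sym; apply: (conn_drop_edges (S := [set e2]) fE (subD1set _ _)).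
  rewrite conn_sym; apply: (conn_drop_edges (S := [set e1]) fE (subxx _)) => //.
  by move=> e /set1P ->.
by move=> e /set1P ->.
Qed.

(** Trading the whole branches [e1] and [e2] between [u] and [v] gives the first inequality; if
    [f u = f v] it comes from the Laplacian at [u]. Hence [esum f e2 <= esum f e1], and then trading
    [b] for a vertex [c] of larger value would lower the energy. *)
Lemma opt_compare u v e1 e2 : u != v -> nonpath E u v e1 -> nonpath E v u e2 ->
  f v <= f u ->
  esum f e2 - f v <= esum f e1 - f u /\
  forall b c, b \in e1 -> b != u -> c \in e2 -> c != v -> f c <= f b.
Proof.
move=> uv n1 n2 fuv; have [e12 cc] := nonpath_pair uv n1 n2.
have du := nonpath_degree uv n1.
have [/and3P[e1E ue1 c1] /and3P[e2E ve2 c2]] := (n1, n2).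
have le : esum f e2 - f v <= esum f e1 - f u.
  have [|H1 H2] := opt_swap e1E e2E e12 ue1 ve2 uv ue1 ve2 cc; first by rewrite !eqxx.
  move: fuv; rewrite le_eqVlt => /predU1P[fe|lt].
    by have := H2 _ du; rewrite fe subrr mul0r => /(_ erefl); lra.
  have : f v - f u < 0 by lra.
  by move=> /nmulr_rle0 E1; rewrite E1 in H1; lra.
split=> // b c be1 bu ce2 cv; have [->//|bc] := eqVneq b c.
have [|H1 _] := opt_swap e1E e2E e12 be1 ce2 bc ue1 ve2 cc.
  by rewrite ![_ == b]eq_sym (negPf bu) eq_sym (negPf cv).
rewrite leNgt; apply/negP => lt; have : 0 < f c - f b by lra.
by move=> /pmulr_rle0 E1; rewrite E1 in H1; lra.
Qed.

Lemma opt_same u e1 e2 b c : e1 \in E -> e2 \in E -> e1 != e2 ->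
  u \in e1 -> u \in e2 -> b \in e1 -> b != u -> c \in e2 -> c != u ->
  esum f e2 <= esum f e1 -> f c <= f b.
Proof.
move=> e1E e2E e12 ue1 ue2 be1 bu ce2 cu le; have [->//|bc] := eqVneq b c.
have [|H1 _] := opt_swap e1E e2E e12 be1 ce2 bc ue1 ue2 (connxx _ _).
  by rewrite ![u == _]eq_sym (negPf bu) (negPf cu).
rewrite leNgt; apply/negP => lt; have : 0 < f c - f b by lra.
by move=> /pmulr_rle0 E1; rewrite E1 in H1; lra.
Qed.

Lemma opt_tie u v e1 e2 : u != v -> nonpath E u v e1 -> nonpath E v u e2 ->
  f u = f v -> esum f e1 = esum f e2 /\
  forall b c, b \in e1 -> b != u -> c \in e2 -> c != v -> f b = f c.
Proof.
move=> uv n1 n2 fuv; have vu : v != u by rewrite eq_sym.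
have [|l1 m1] := opt_compare uv n1 n2; first by rewrite fuv.
have [|l2 m2] := opt_compare vu n2 n1; first by rewrite fuv.
split; first by move: l1 l2; rewrite fuv; lra.
by move=> b c be bu ce cv; apply/eqP; rewrite eq_le (m2 c b) // (m1 b c).
Qed.

Lemma nonpath_esum_const u v : u != v -> f u = f v -> degree E v != 1%N ->
  forall e e', nonpath E u v e -> nonpath E u v e' -> esum f e = esum f e'.
Proof.
move=> uv fuv dv e e' ne ne'; rewrite eq_sym in uv.
have [g ng] := nonpath_exists uv dv; rewrite eq_sym in uv.
by have [-> _] := opt_tie uv ne ng fuv; have [-> _] := opt_tie uv ne' ng fuv.
Qed.

(** All branches of [u] away from [v] have one common sum, so the eigenvalue equation involves only
    two edge sums and can be compared between [u] and [v]. *)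
Lemma lap_path u v g e : u != v -> f u = f v -> degree E v != 1%N ->
  g \in E -> u \in g -> ~~ conn (E :\ g) u v -> nonpath E u v e ->
  mu * f u = k%:R * (degree E u)%:R * f u - (esum f g + (degree E u).-1%:R * esum f e).
Proof.
move=> uv fuv dv gE ug ng ne; have du := nonpath_degree uv ne.
rewrite -(opt_lap oE du) /lap (path_sum _ uv gE ug ng).
rewrite (eq_bigr (fun=> esum f e)); last first.
  by move=> e' ne'; exact: (nonpath_esum_const uv fuv dv).
have [g' [_ _ _ ->]] := pathE uv; rewrite /= sumr_const.
by rewrite -[in LHS](mulr_natl (esum f e)) cardsE.
Qed.

(** If [u] had the larger degree, moving its surplus to [v] would keep the energy, and the tie
    condition makes every branch of [u] have sum [k * f u]. By [opt_tie] the vertices of a branch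
    [e1] other than [u] share one value, hence all have value [f u]. Comparing [u] with such a
    vertex [b] shows that the edge towards [v] has the same sum, and the eigenvalue equation becomes
    [mu * f u = 0]. *)
Lemma opt_degree_le u v : u != v -> f u = f v -> degree E u != 1%N ->
  (degree E u <= degree E v)%N.
Proof.
move=> uv fuv du; rewrite leqNgt; apply/negP => lt.
have fu := opt_gt0 du.
have dv : degree E v != 1%N by rewrite -(opt_eq0 oE) -fuv gt_eqF.
have vu : v != u by rewrite eq_sym.
have [g [gE ug npE dE]] := pathE uv.
have [g' [g'E vg' npE' dE']] := pathE vu.
have ng : ~~ conn (E :\ g) u v.
  by have := npE g; rewrite /nonpath gE ug eqxx /= => ->.
have [e2 ne2] := nonpath_exists vu dv.
have [S SN cS] : exists2 S : {set {set T}}, S \subset [set e | nonpath E u v e] &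
  #|S| = (degree E u - degree E v)%N.
  by apply: subset_of_card; rewrite dE dE' subSS leq_subr.
have Su e : e \in S -> nonpath E u v e by move=> /(subsetP SN); rewrite inE.
have cS' : (#|S| + degree E v = degree E u)%N by rewrite cS subnK // ltnW.
have [_ H] := opt_shift uv du dv Su cS'.
have s0 : #|S|%:R != 0 :> R by rewrite pnatr_eq0 cS subn_eq0 -ltnNge.
have k0 : k%:R != 0 :> R by rewrite pnatr_eq0; case: k k2.
(* [v] is interior, so it has degree at least two and [u] at least three: one edge leads to [v], two
   do not. *)
have [e1 [e1' [n1 n1' e11]]] : exists e1 e1',
    [/\ nonpath E u v e1, nonpath E u v e1' & e1 != e1'].
  have : (1 < #|[set e | nonpath E u v e]|)%N.
    by move: lt dv; rewrite dE dE' ltnS eqSS -lt0n => l1 l2; exact: leq_ltn_trans l2 l1.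
  by move=> /card_gt1P[a [a' []]]; rewrite !inE => ? ? ?; exists a, a'.
have e1k : esum f e1 = k%:R * f u.
  have : k%:R * #|S|%:R * f u = \sum_(e in S) esum f e.
    apply: H; rewrite fuv !subrr mulr0 sub0r; apply/eqP; rewrite oppr_eq0.
    by rewrite big1 // => e _; rewrite addr0 subrr.
  rewrite (eq_bigr (fun=> esum f e1)); last first.
    by move=> e /Su ne; exact: (nonpath_esum_const uv fuv dv).
  rewrite sumr_const -(mulr_natl (esum f e1)) => sE; apply: (mulfI s0).
  by rewrite -sE mulrA [_ * k%:R]mulrC.
have [/and3P[e1E ue1 c1] /and3P[e1'E ue1' c1']] := (n1, n1').
have [b be1 [bu fb]] : exists2 b, b \in e1 & b != u /\ f b = f u.
  have /and3P[e2E ve2 _] := ne2; have [c ce2 cv] := edge_other e2E ve2.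
  have [_ mem] := opt_tie uv n1 ne2 fuv.
  have eS : esum f e1 = f u + k.-1%:R * f c.
    rewrite /esum (big_setD1 u ue1) /= (eq_bigr (fun=> f c)); last first.
      by move=> x; rewrite !inE => /andP[xu xe]; exact: mem.
    rewrite sumr_const -(mulr_natl (f c)); congr (_ + _%:R * _).
    by have := uE e1E; rewrite (cardsD1 u) ue1 => <-.
  have [b be bu] := edge_other e1E ue1; exists b => //; split=> //.
  rewrite (mem b c) //; have k1 : k.-1%:R != 0 :> R by rewrite pnatr_eq0; case: k k2 => [|[]].
  apply: (mulfI k1); move: eS; rewrite e1k -[in k%:R](ltn_predK k2) -natr1.
  by rewrite mulrDl mul1r addrC => /addrI ->.
have ub : u != b by rewrite eq_sym.
have db : degree E b != 1%N by rewrite -(opt_eq0 oE) fb gt_eqF.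
have [eb nb] := nonpath_exists bu db.
(* The edge from [u] towards [b] is [e1], so relative to [b] both [g] and [e1'] are branches and
   have equal sums. *)
have nu e : e \in E -> u \in e -> e != e1 -> nonpath E u b e.
  have [g0 [_ _ nE _]] := pathE ub.
  have e10 : e1 = g0.
    apply/eqP; apply: contraT => e10; have := nE e1.
    rewrite e1E ue1 e10 /nonpath e1E ue1 /= => cub.
    by case/eqP: ub; exact: (fE e1E).
  by move=> eE ue; rewrite nE eE ue e10.
have gE1 : g != e1 by apply: contraNneq ng => ->.
have [Eg _] := opt_tie ub (nu _ gE ug gE1) nb (esym fb).
have e11' : e1' != e1 by rewrite eq_sym.
have [Ee _] := opt_tie ub (nu _ e1'E ue1' e11') nb (esym fb).
have ee := nonpath_esum_const uv fuv dv n1 n1'.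
have := lap_path uv fuv dv gE ug ng n1; rewrite Eg -Ee -ee e1k.
have -> : (degree E u)%:R = (degree E u).-1%:R + 1 :> R.
  by rewrite natr1 prednK // dE.
have mu0 : 0 < mu by apply: (opt_mu oE); apply/set0Pn; exists g.
move=> muE; have := mulr_gt0 mu0 fu; rewrite muE.
suff -> : forall K d x : R, K * (d + 1) * x - (K * x + d * (K * x)) = 0 by rewrite ltxx.
by move=> K d x; ring.
Qed.

Lemma opt_degree u v : u != v -> f u = f v -> degree E u != 1%N ->
  degree E u = degree E v.
Proof.
move=> uv fuv du; apply/eqP; rewrite eqn_leq opt_degree_le //=.
have vu : v != u by rewrite eq_sym.
apply: (opt_degree_le vu (esym fuv)).
by rewrite -(opt_eq0 oE) -fuv gt_eqF // opt_gt0.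
Qed.

(** The eigenvalue equations at [u] and [v] share values, degrees and branch sums, so the remaining
    terms agree. *)
Lemma opt_path_esum u v g g' : u != v -> f u = f v -> degree E u != 1%N ->
  g \in E -> u \in g -> ~~ conn (E :\ g) u v ->
  g' \in E -> v \in g' -> ~~ conn (E :\ g') v u -> esum f g = esum f g'.
Proof.
move=> uv fuv du gE ug ng g'E vg' ng'; have vu : v != u by rewrite eq_sym.
have dv : degree E v != 1%N by rewrite -(opt_degree uv fuv du).
have [e1 n1] := nonpath_exists uv du; have [e2 n2] := nonpath_exists vu dv.
have := lap_path uv fuv dv gE ug ng n1.
have := lap_path vu (esym fuv) du g'E vg' ng' n2.
have [-> _] := opt_tie uv n1 n2 fuv.
by rewrite (opt_degree uv fuv du) fuv => ->; lra.
Qed.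

End Optimal.

(** * The ordering of a minimizer *)

Section StrictTotal.

Definition strict_total (X : eqType) (lt : rel X) : Prop :=
  [/\ irreflexive lt, transitive lt & forall x y, x != y -> lt x y || lt y x].

Lemma strict_total_asym (X : eqType) (lt : rel X) x y :
  strict_total lt -> lt x y -> lt y x -> False.
Proof. by case=> irr tr _ xy yx; have := tr _ _ _ xy yx; rewrite irr. Qed.

Definition lex (X Y : eqType) (key : X -> Y) (lt1 : rel Y) (lt2 : rel X) : rel X :=
  fun x y => if key x == key y then lt2 x y else lt1 (key x) (key y).

Lemma strict_total_lex (X Y : eqType) (key : X -> Y) lt1 lt2 :
  strict_total lt1 -> strict_total lt2 -> strict_total (lex key lt1 lt2).
Proof.
move=> s1 s2; have [i1 t1 o1] := s1; have [i2 t2 o2] := s2; split.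
- by move=> x; rewrite /lex eqxx i2.
- move=> y x z; rewrite /lex; have [->|xy] := eqVneq (key x) (key y).
    by case: eqVneq => // _; exact: t2.
  have [<-|yz] := eqVneq (key y) (key z); first by rewrite (negPf xy).
  have [->|xz] := eqVneq (key x) (key z); last exact: t1.
  by move=> a b; case: (strict_total_asym s1 a b).
- move=> x y xy; rewrite /lex [key y == _]eq_sym; case: eqVneq => [_|k]; first exact: o2.
  exact: o1.
Qed.

Definition desc_lt (R : realType) (X : finType) (F : X -> R) : rel X :=
  fun x y => (F y < F x) || (F x == F y) && (enum_rank x < enum_rank y)%N.

Lemma strict_total_desc (R : realType) (X : finType) (F : X -> R) :
  strict_total (desc_lt F).
Proof.
rewrite /desc_lt; split.
- by move=> x; rewrite ltxx eqxx ltnn.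
- move=> y x z /orP[xy|/andP[/eqP xy rxy]] /orP[yz|/andP[/eqP yz ryz]].
  + by rewrite (lt_trans yz xy).
  + by rewrite -yz xy.
  + by rewrite xy yz.
  + by rewrite xy yz eqxx (ltn_trans rxy ryz) orbT.
- move=> x y xy; case: (ltgtP (F x) (F y)) => //= _.
  by rewrite -neq_ltn; apply: contraNneq xy => /val_inj/enum_rank_inj ->.
Qed.

Lemma desc_lt_le (R : realType) (X : finType) (F : X -> R) x y :
  desc_lt F x y -> F y <= F x.
Proof. by move=> /orP[/ltW//|/andP[/eqP -> _]]. Qed.

End StrictTotal.

(** * Monotonicity of the eigenfunction and of the degrees *)

Section OptimalOrder.
Variables (R : realType) (T : finType) (k : nat) (E : {set {set T}}).
Variables (f : T -> R) (mu : R) (v0 : T) (h : T -> nat).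
Hypotheses (k2 : (2 <= k)%N) (oE : optimal k E f mu).
Hypotheses (hE : height_fun E v0 h) (fmax : forall v, f v <= f v0).
Implicit Types (e g : {set T}) (u v w b c p q : T).

Notation tp := (top v0 h).
Notation pe := (pedge E v0 h).
Notation par := (parent E v0 h).

Let fE : forest E. Proof. by case: (opt_tree oE). Qed.
Let uE e : e \in E -> #|e| = k. Proof. by case: (opt_tree oE) => H _ _; exact: H. Qed.
Let E0 : set0 \notin E. Proof. exact: (uniform_neq0 k2 uE). Qed.
Let h_eq0 v : (h v == 0%N) = (v == v0). Proof. by case: hE. Qed.

Let tople e y : e \in E -> y \in e -> (h (tp e) <= h y)%N. Proof. exact: top_le. Qed.
Let conntop e : e \in E -> conn (E :\ e) (tp e) v0. Proof. exact: conn_top. Qed.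
Let pedgeu e v : e \in E -> v \in e -> v != tp e -> v != v0 /\ e = pe v.
Proof. exact: pedge_uniq. Qed.
Let hpar v : v != v0 -> h v = (h (par v)).+1. Proof. exact: h_parent. Qed.
Let parin v : v != v0 -> par v \in pe v. Proof. exact: parent_in. Qed.

(** [q] ranges over the subtree of [p]. If [f p < f q], comparing a branch [g] of [q] with the
    parent edge of [p] gives [g] the strictly larger sum, and gives a vertex [q'] of [g] a value at
    least that of the parent [p'] of [p]. By induction, or because the root is a maximum,
    [f q' <= f p']. So [q'] and [p'] are tied, and [opt_path_esum] makes the two sums equal. *)
Lemma opt_below p q : p != v0 -> conn (E :\ pe p) p q -> f q <= f p.
Proof.
have [n] := ubnP (h p); elim: n p q => // n IH p q; rewrite ltnS => hn pv cpq.
rewrite leNgt; apply/negP => fpq.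
have qp : q != p by apply: contraTneq fpq => ->; rewrite ltxx.
have pq : p != q by rewrite eq_sym.
have [epE pep pp] := pedgeP hE pv; set ep := pe p in epE pep cpq.
have p'ep : par p \in ep by exact: parin.
set p' := par p in pp p'ep.
have np : nonpath E p q ep by rewrite /nonpath epE pep cpq.
have dq : degree E q != 1%N.
  by rewrite -(opt_eq0 oE) gt_eqF // (le_lt_trans (opt_ge0 oE p)).
have [g ng] := nonpath_exists oE qp dq.
have [gE qg cqp] := and3P ng.
have [gep _] := nonpath_pair oE qp ng np.
have [le mem] := opt_compare k2 oE qp ng np (ltW fpq).
have [q' q'g q'q] := edge_other k2 oE gE qg.
have le' : f p' <= f q' by exact: mem.
have lt : esum f ep < esum f g by move: le fpq; lra.
have npp' : ~~ conn (E :\ ep) p p'.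
  by apply/negP => cc; case/eqP: pp; symmetry; exact: (fE epE).
have eqx : f q' = f p'.
  apply/eqP; rewrite eq_le le' andbT.
  have [->|p'v] := eqVneq p' v0; first exact: fmax.
  have [e''E p'e'' pp''] := pedgeP hE p'v.
  have ee : pe p' != ep.
    apply: contraNneq pp'' => ee; by rewrite /parent ee.
  have ge : g != pe p'.
    apply: contraNneq npp' => ge; apply: conn_trans cpq _.
    have p'g : p' \in g by rewrite ge.
    by apply: (conn_edge _ qg p'g); rewrite !inE gep.
  apply: IH => //.
    by apply: leq_trans hn; rewrite (hpar pv).
  apply: conn_trans (_ : conn _ p' p) _.
    by apply: (conn_edge (e := ep)); rewrite // !inE eq_sym ee.
  apply: conn_trans (_ : conn _ p q) _.
    apply: conn_subset (conn_avoid1 p'e'' npp' cpq); exact: setSD (subD1set _ _).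
  by apply: (conn_edge (e := g)); rewrite // !inE ge.
have geE : g \in E :\ ep by rewrite !inE gep.
have epgE : ep \in E :\ g by rewrite !inE eq_sym gep.
have qq' : conn (E :\ ep) p q' by apply: conn_trans cpq (conn_edge geE qg q'g).
have q'p' : q' != p' by apply: contraNneq npp' => <-.
have fp' : 0 < f p'.
  have [->|p'v] := eqVneq p' v0.
    by apply: lt_le_trans (fmax q); apply: opt_gt0 oE _ dq.
  apply: (opt_gt0 oE); apply: (nonpath_degree oE p'v (e := ep)).
  by rewrite /nonpath epE p'ep; exact: conntop.
have dq' : degree E q' != 1%N by rewrite -(opt_eq0 oE) eqx gt_eqF.
have : esum f g = esum f ep; last by move: lt; lra.
apply: (opt_path_esum k2 oE q'p' eqx dq' gE q'g _ epE p'ep).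
  apply/negP => cc; case/eqP: q'q; apply: (fE gE) => //.
  apply: conn_trans cc _; apply: conn_trans (conn_edge epgE p'ep pep) _.
  by rewrite conn_sym.
by apply: contra npp' => cc; apply: conn_trans qq' _; rewrite conn_sym.
Qed.

(** By induction the parents of [b] and [c] are in the right order, and [opt_compare] passes this to
    the children unless the parent of [b] lies in the parent edge of [c]. There the two parent edges
    meet, or [c] is itself the parent of [b]. *)
Lemma opt_next_level c b : h b = (h c).+1 -> f b <= f c.
Proof.
have [n] := ubnP (h c); elim: n c b => // n IH c b; rewrite ltnS => hn hb.
have [->|cv] := eqVneq c v0; first exact: fmax.
have bv : b != v0 by rewrite -h_eq0 hb.
have [ecE cec pc] := pedgeP hE cv; have [ebE beb pb] := pedgeP hE bv.
have wec := parin cv; have ueb := parin bv.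
have hc := hpar cv; have hb' := hpar bv.
set w := par c in pc wec hc; set u := par b in pb ueb hb'.
set ec := pe c in ecE cec wec; set eb := pe b in ebE beb ueb.
have tec : tp ec = w by []. have teb : tp eb = u by [].
have huw : h u = (h w).+1 by move: hb; rewrite hb' hc => -[].
have fuw : f u <= f w by apply: IH huw; rewrite -ltnS -hc.
have uw : w != u.
  by apply/negP => /eqP wu; move: huw; rewrite wu => /esym/eqP; rewrite gtn_eqF.
have ceb : forall z, z \in eb -> (h u <= h z)%N by move=> z; rewrite -teb; exact: tople.
have [uec|uec] := boolP (u \in ec); last first.
  have nw : nonpath E w u ec.
    rewrite /nonpath ecE wec; apply: conn_trans (conntop ecE) _.
    rewrite conn_sym; apply: (conn_low1 hE uec) => z zec.
    by rewrite huw ltnS -tec tople.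
  have nu : nonpath E u w eb.
    rewrite /nonpath ebE ueb; apply: conn_trans (conntop ebE) _.
    rewrite conn_sym; apply: (conn_low hE) => z zeb.
    by apply: leq_trans (ceb _ zeb); rewrite huw.
  have [_ mem] := opt_compare k2 oE uw nw nu fuw.
  by apply: mem; rewrite // eq_sym.
have [uv ecu] : u != v0 /\ ec = pe u by apply: pedgeu; rewrite // tec eq_sym.
have ecb : ec != eb by apply: contra uw => /eqP ee; rewrite -tec -teb ee.
have ebu : eb \in E :\ ec by rewrite !inE eq_sym ecb.
have [->|cu] := eqVneq c u.
  by apply: opt_below => //; rewrite -ecu; exact: (conn_edge ebu).
have bu : b != u by rewrite eq_sym.
have [le|lt] := leP (esum f eb) (esum f ec).
  exact: (opt_same k2 oE ecE ebE ecb uec ueb cec cu beb bu le).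
(* The edge of larger sum has the larger values, so [f w <= f b]; but [b] lies below [w]. The
   resulting tie makes the two sums equal. *)
have fwb : f w <= f b.
  have ebc : eb != ec by rewrite eq_sym.
  exact: (opt_same k2 oE ebE ecE ebc ueb uec beb bu wec uw (ltW lt)).
have ecbE : ec \in E :\ eb by rewrite !inE ecb.
have fbw : f b <= f w.
  have [->|wv] := eqVneq w v0; first exact: fmax.
  have [ewE wew pw] := pedgeP hE wv.
  have ewc : ec != pe w by apply: contraNneq pw => ee; rewrite /parent -ee tec.
  have ewb : eb != pe w.
    apply/negP => /eqP ee; have := ceb w; rewrite ee => /(_ wew).
    by rewrite huw ltnn.
  apply: opt_below => //; apply: conn_trans (_ : conn _ w u) _.
    by apply: (conn_edge (e := ec)); rewrite // !inE ewc.
  by apply: (conn_edge (e := eb)); rewrite // !inE ewb.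
have fwbE : f w = f b by apply/eqP; rewrite eq_le fwb.
have fu : 0 < f u.
  apply: (opt_gt0 oE); apply: (nonpath_degree oE uv (e := eb)).
  by rewrite /nonpath ebE ueb; exact: conntop.
have dw : degree E w != 1%N by rewrite -(opt_eq0 oE) gt_eqF // (lt_le_trans fu).
have wb : w != b by apply/negP => /eqP wb; move: hb'; rewrite -wb huw => /eqP; rewrite ltn_eqF.
have : esum f ec = esum f eb; last by move: lt; lra.
apply: (opt_path_esum k2 oE wb fwbE dw ecE wec _ ebE beb).
  apply/negP => cc; case/eqP: uw; apply: (fE ecE) => //.
  apply: conn_trans cc _; exact: (conn_edge ebu).
apply/negP => cc; case/eqP: bu; apply: (fE ebE) => //.
apply: conn_trans cc _; exact: (conn_edge ecbE).
Qed.

Lemma opt_level c b : (h c < h b)%N -> f b <= f c.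
Proof.
have [n] := ubnP (h b); elim: n b => // n IH b; rewrite ltnS => hn hcb.
have bv : b != v0 by rewrite -h_eq0 -lt0n (leq_ltn_trans _ hcb).
have hb := hpar bv; move: hcb; rewrite hb ltnS leq_eqVlt.
case/predU1P=> [hc|lt]; first by apply: opt_next_level; rewrite hc.
apply: le_trans (opt_next_level hb) (IH _ _ lt).
by rewrite -hb.
Qed.

(** The recursion climbs to the parents, with the common height as its depth. Comparing parents
    first yields (S2); comparing parent edges before values keeps siblings of one edge contiguous,
    as (S4) asks. *)
Fixpoint level_lt n : rel T :=
  if n is n'.+1 then lex par (level_lt n') (lex pe (desc_lt (esum f)) (desc_lt f))
  else desc_lt f.

Definition tree_lt : rel T :=
  fun u v => if h u == h v then level_lt (h u) u v else (h u < h v)%N.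

Lemma strict_total_level n : strict_total (level_lt n).
Proof.
elim: n => [|n IH] /=; first exact: strict_total_desc.
by apply: strict_total_lex => //; apply: strict_total_lex; exact: strict_total_desc.
Qed.

Lemma strict_total_tree : strict_total tree_lt.
Proof.
rewrite /tree_lt; split.
- by move=> x; rewrite eqxx; case: (strict_total_level (h x)) => ->.
- move=> y x z; have [hxy|nxy] := eqVneq (h x) (h y); have [hyz|nyz] := eqVneq (h y) (h z).
  + by rewrite hxy hyz eqxx; case: (strict_total_level (h z)) => _ tr _; exact: tr.
  + by rewrite hxy (negPf nyz).
  + by rewrite -hyz (negPf nxy).
  + by move=> xy yz; have xz := ltn_trans xy yz; rewrite ltn_eqF.
- move=> x y xy; rewrite [h y == _]eq_sym; case: eqVneq => [hxy|].
    by rewrite -hxy; case: (strict_total_level (h x)) => _ _; exact.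
  by rewrite neq_ltn.
Qed.

Lemma tree_lt_height u v : tree_lt u v -> (h u <= h v)%N.
Proof. by rewrite /tree_lt; case: eqVneq => [->//|_ /ltnW]. Qed.

Lemma level_lt_le n u v : h u = n -> h v = n -> level_lt n u v -> f v <= f u.
Proof.
elim: n u v => [|n IH] u v hu hv /=; first exact: desc_lt_le.
have uv : u != v0 by rewrite -h_eq0 hu.
have vv : v != v0 by rewrite -h_eq0 hv.
have [uE' upe pu] := pedgeP hE uv; have [vE' vpe pv] := pedgeP hE vv.
have hpu := hpar uv; have hpv := hpar vv.
have pup := parin uv; have pvp := parin vv.
rewrite eq_sym in pu; rewrite eq_sym in pv.
rewrite /lex; have [pp|pp] := eqVneq (par u) (par v).
  case: eqVneq => [_|ee]; first exact: desc_lt_le.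
  move/desc_lt_le => le; apply: (opt_same k2 oE uE' vE' ee pup) => //.
  by rewrite pp.
  by rewrite pp.
move=> lt; have {IH}fle : f (par v) <= f (par u).
  by apply: IH lt; apply: succn_inj; rewrite -?hpu -?hpv.
have hh : h (par u) = h (par v) by apply: succn_inj; rewrite -hpu -hpv hu.
have nu : nonpath E (par u) (par v) (pe u).
  rewrite /nonpath uE' pup; apply: conn_trans (conntop uE') _.
  by rewrite conn_sym; apply: (conn_low hE) => z; rewrite -hh; exact: tople.
have nv : nonpath E (par v) (par u) (pe v).
  rewrite /nonpath vE' pvp; apply: conn_trans (conntop vE') _.
  by rewrite conn_sym; apply: (conn_low hE) => z; rewrite hh; exact: tople.
have [_ mem] := opt_compare k2 oE pp nu nv fle; exact: mem.
Qed.

Lemma tree_lt_le u v : tree_lt u v -> f v <= f u.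
Proof.
rewrite /tree_lt; case: eqVneq => [huv|_]; last exact: opt_level.
exact: level_lt_le.
Qed.

(** Vertices between [u] and [v] are interior, so one may take [u] and [v] consecutive. If
    [f v < f u] and [u] had the larger degree, its surplus could be moved to [v] along edges whose
    other vertices are children of [u]. These come after [v], so their values are at most [f v], and
    the move lowers the energy. *)
Lemma tree_lt_degree u v : degree E u != 1%N -> degree E v != 1%N ->
  tree_lt u v -> (degree E u <= degree E v)%N.
Proof.
have st := strict_total_tree; have [irr tr tot] := st.
have [n] := ubnP #|[set w | tree_lt u w && tree_lt w v]|.
elim: n u v => // n IH u v; rewrite ltnS => hn du dv uv.
have [/existsP[w /andP[uw wv]]|none] := boolP [exists w, tree_lt u w && tree_lt w v].
  have dw : degree E w != 1%N.
    rewrite -(opt_eq0 oE) gt_eqF // (lt_le_trans (opt_gt0 oE dv)) //.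
    exact: tree_lt_le.
  have wI : w \in [set w | tree_lt u w && tree_lt w v] by rewrite inE uw.
  apply: leq_trans (IH u w _ du dw uw) (IH w v _ dw dv wv);
    apply: leq_trans hn; apply: proper_card; apply/properP; split.
  - apply/subsetP => x; rewrite !inE => /andP[ux xw].
    by rewrite ux (tr _ _ _ xw wv).
  - by exists w => //; rewrite inE irr andbF.
  - apply/subsetP => x; rewrite !inE => /andP[wx xv].
    by rewrite xv (tr _ _ _ uw wx).
  - by exists w => //; rewrite inE irr.
have nuv : u != v by apply: contraTneq uv => ->; rewrite irr.
move: (tree_lt_le uv); rewrite le_eqVlt => /predU1P[fuv|fuv].
  by rewrite (opt_degree k2 oE nuv (esym fuv) du).
rewrite leqNgt; apply/negP => dlt.
have [g [_ _ _ dE]] := pathE oE nuv.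
(* Only edges below [u] are kept. Excluding the parent edge costs at most one branch, and enough
   remain because [v] has degree at least two. *)
pose N := [set e | nonpath E u v e] :\ pe u.
have dv2 : (1 < degree E v)%N.
  have vu : v != u by rewrite eq_sym.
  have [_ [_ _ _ dE']] := pathE oE vu.
  by move: dv; rewrite dE' eqSS -lt0n.
have cN : (degree E u - degree E v <= #|N|)%N.
  have le : (#|[set e | nonpath E u v e]| <= 1 + #|N|)%N.
    by rewrite [X in (X <= _)%N](cardsD1 (pe u)) leq_add2r leq_b1.
  rewrite leq_subLR dE; apply: leq_ltn_trans le _.
  by rewrite ltn_add2r.
have [S SN cS] := subset_of_card cN.
have Su e : e \in S -> nonpath E u v e.
  by move=> /(subsetP SN); rewrite !inE => /andP[_].
have cS' : (#|S| + degree E v = degree E u)%N by rewrite cS subnK // ltnW.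
have [D0 _] := opt_shift k2 oE nuv du dv Su cS'.
have key e : e \in S -> esum f e <= f u + k.-1%:R * f v.
  move=> eS; have /and3P[eE ue ce] := Su e eS.
  have eu : tp e = u.
    apply/eqP; apply: contraT => teu; have [_ ee] : u != v0 /\ e = pe u.
      by apply: pedgeu; rewrite // eq_sym.
    by have := subsetP SN _ eS; rewrite !inE ee eqxx.
  have c1 : #|e :\ u| = k.-1 by rewrite -(uE eE) (cardsD1 u e) ue.
  rewrite /esum (big_setD1 u ue) /= lerD2l mulr_natl -c1 -sumr_const.
  apply: ler_sum => x; rewrite !inE => /andP[xu xe].
  have xv : x != v.
    by apply: contraTneq xe => ->; exact: (nonpath_notin (opt_tree oE) nuv).
  apply: tree_lt_le; have [xv'|//] := orP (tot _ _ xv).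
  have ux : tree_lt u x.
    have hx : h x = (h u).+1 by rewrite -eu; apply: (top_lt hE fE E0); rewrite ?eu.
    by rewrite /tree_lt hx ltn_eqF.
  by case/existsP: none; exists x; rewrite ux xv'.
have S0 : S != set0 by rewrite -card_gt0 cS subn_gt0.
have [e0 e0S] := set0Pn _ S0.
move: D0; rewrite leNgt => /negP; apply.
have kE : k%:R = k.-1%:R + 1 :> R by rewrite natr1 (ltn_predK k2).
have k1 : 0 < k.-1%:R :> R by rewrite ltr0n; case: k k2 => [|[]].
have termE e : e \in S -> k%:R * (f v ^+ 2 - f u ^+ 2) -
    ((esum f e + (f v - f u)) ^+ 2 - esum f e ^+ 2) < 0.
  move=> /key; rewrite kE; move: (esum f e) (k.-1%:R) k1 (f u) (f v) fuv.
  move=> F K K0 x y yx le.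
  have -> : (K + 1) * (y ^+ 2 - x ^+ 2) - ((F + (y - x)) ^+ 2 - F ^+ 2) =
    (x - y) * (2 * (F - (x + K * y)) - K * (x - y)) by ring.
  have xy : 0 < x - y by lra.
  rewrite pmulr_rlt0 //; have := mulr_gt0 K0 xy; lra.
have -> : k%:R * #|S|%:R * (f v ^+ 2 - f u ^+ 2) = \sum_(e in S) k%:R * (f v ^+ 2 - f u ^+ 2).
  by rewrite sumr_const -[RHS]mulr_natl; ring.
rewrite -sumrB (bigD1 e0) //= -[X in _ < X](addr0 0); apply: ltr_leD.
  exact: termE.
by apply: sumr_le0 => e /andP[/termE/ltW].
Qed.

End OptimalOrder.

Lemma optimal_SLO (R : realType) (T : finType) (k : nat) (E : {set {set T}})
    (f : T -> R) (mu : R) (x0 : T) :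
  (2 <= k)%N -> optimal k E f mu -> has_SLO_ordering (@Hypergraph T E).
Proof.
move=> k2 oE; pose v0 := [arg max_(v > x0) f v]%O.
have fmax v : f v <= f v0 by rewrite /v0; case: arg_maxP => // i _; apply.
have [uE cE fE] := opt_tree oE.
pose h : T -> nat := @height (@Hypergraph T E) v0.
have hE : height_fun E v0 h by exact: height_height_fun.
have E0 : set0 \notin E by exact: (uniform_neq0 k2 uE).
have st := strict_total_tree E f v0 h; have [irr tr tot] := st.
pose lt := tree_lt E f v0 h.
have parP p c : @is_parent (@Hypergraph T E) v0 p c -> c != v0 /\ p = parent E v0 h c.
  move=> /andP[/andP[_ ex] hc]; have := is_parentE hE fE E0 p c.
  by rewrite hc ex => /esym/andP[? /eqP].
have le u v := tree_lt_le k2 oE hE fmax (u := u) (v := v).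
exists v0, lt; split=> //.
- by move=> u v; exact: tree_lt_height.
- move=> u v u1 v1 /parP[u1v uE1] /parP[v1v vE1].
  have hu := h_parent hE fE E0 u1v; have hv := h_parent hE fE E0 v1v.
  rewrite -uE1 in hu; rewrite -vE1 in hv.
  have [->|uv] := eqVneq u v; first by rewrite /lt irr.
  rewrite /lt /tree_lt hu hv eqSS; case: eqVneq => [huv|] //=.
  by rewrite /lex -uE1 -vE1 (negPf uv) huv.
- move=> u v /le fvu; rewrite !inE -!/(degree E _) -!(opt_eq0 oE) => /eqP fu.
  by rewrite eq_le (opt_ge0 oE) andbT -fu.
- move=> e s eE ss se i w i0 isz we; apply/negP => /andP[l1 l2].
  have nthE j : (j < size s)%N -> nth w s j \in e by move=> jsz; rewrite -se mem_nth.
  (* The top of [e] has the least height and so comes first in [s]; the entries from index 1 on have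
     [e] as parent edge. *)
  have nottop j : (0 < j)%N -> (j < size s)%N -> nth w s j != top v0 h e.
    move=> j0 jsz; have s0 := leq_ltn_trans (leq0n _) jsz.
    have lt0j : lt (nth w s 0) (nth w s j).
      by apply: (sorted_ltn_nth tr w ss); rewrite ?inE.
    apply: contraTneq lt0j => sj; apply/negP => l.
    have n0 : nth w s 0 != top v0 h e.
      by apply: contraTneq l => ->; rewrite sj /lt irr.
    have := tree_lt_height l; rewrite sj.
    by rewrite (top_lt hE fE E0 eE (nthE _ s0) n0) ltnn.
  have ai := nthE _ (ltnW isz); have bi := nthE _ isz.
  have at_ := nottop i i0 (ltnW isz); have bt := nottop i.+1 isT isz.
  set a := nth w s i in l1 ai at_; set b := nth w s i.+1 in l2 bi bt.
  have ha := top_lt hE fE E0 eE ai at_; have hb := top_lt hE fE E0 eE bi bt.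
  (* [w] is squeezed between two vertices with the same height, parent and parent edge. Asymmetry at
     each level of the comparison would force [w] into [e]. *)
  have hw : h w = (h (top v0 h e)).+1.
    apply/eqP; rewrite eqn_leq -{1}hb -ha (tree_lt_height l1).
    by rewrite (tree_lt_height l2).
  have [_ ea] := pedge_uniq hE fE E0 eE ai at_.
  have [_ eb] := pedge_uniq hE fE E0 eE bi bt.
  have wv : w != v0 by case: hE => H _ _; rewrite -H hw.
  have [pE wp _] := pedgeP hE wv.
  have ew : e != pedge E v0 h w by apply: contraNneq we => ->.
  move: l1 l2; rewrite /lt /tree_lt ha hb hw eqxx /= /lex /parent -ea -eb.
  rewrite -/(parent E v0 h w) [parent _ _ _ _ == _]eq_sym.
  case: eqVneq => [_|_]; last first.
    by move=> l1 l2; exact: (strict_total_asym (strict_total_level _ _ _ _ _) l1 l2).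
  rewrite [pedge _ _ _ _ == _]eq_sym (negPf ew) => l1 l2.
  exact: (strict_total_asym (strict_total_desc _) l1 l2).
- move=> u v; rewrite !inE => du dv; exact: (tree_lt_degree k2 oE hE fmax du dv).
Qed.

(** * From the Faber-Krahn property to a minimizer *)

Section Rayleigh.
Variables (R : realType) (k : nat).
Hypothesis k2 : (2 <= k)%N.

Let k1 : 0 < k.-1%:R :> R. Proof. by rewrite ltr0n; case: k k2 => [|[]]. Qed.

(** Perturbing by the indicator of an interior vertex gives a nonnegative quadratic in [t], whose
    linear coefficient vanishes. It is stated for an arbitrary minimizer because the same [f] is
    used on competing trees. *)
Lemma minimizer_laplacian (G : hypergraph) (f : G -> R) :
  supertree k G -> dirichlet_function f ->
  (forall g : G -> R, dirichlet_function g -> rayleigh k f <= rayleigh k g) ->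
  forall u, u \in interior_vertices G -> laplacian k f u = rayleigh k f * f u.
Proof.
move=> stG df fmin w wi; set r := rayleigh k f.
have Nf : 0 < \sum_v f v ^+ 2 by apply: sum_sq_gt0; case: df.
have Ef : dirichlet_energy k f = r * \sum_v f v ^+ 2.
  by rewrite /r /rayleigh divfK // gt_eqF.
pose d v : R := (v == w)%:R.
have sum_d (h : G -> R) : \sum_v h v * d v = h w.
  rewrite (bigD1 w) //= /d eqxx mulr1 big1 ?addr0 // => v /negPf ->.
  by rewrite mulr0.
have ge0 t : 0 <= dirichlet_energy k (fun v => f v + t * d v) -
    r * \sum_v (f v + t * d v) ^+ 2.
  have [z|nz] := eqVneq (\sum_v (f v + t * d v) ^+ 2) 0.
    rewrite z mulr0 subr0 mulr_ge0 ?invr_ge0 //.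
    apply: sumr_ge0 => u _; apply: sumr_ge0 => v _.
    by rewrite mulr_ge0 ?sqr_ge0 // invr_ge0 ltW.
  have ex := sum_sq_neq0 nz; rewrite subr_ge0 -ler_pdivlMr ?sum_sq_gt0 //.
  apply: fmin; split=> // v vb; case: (df) => _ -> //; rewrite /d.
  case: eqVneq => [vw|_]; last by rewrite mulr0 addr0.
  by move: wi; rewrite /interior_vertices inE -vw vb.
suff : 2 * (laplacian k f w - r * f w) = 0 by lra.
apply: (@lin_quad_ge0 _ _ (dirichlet_energy k d - r * \sum_v d v ^+ 2)) => t.
suff -> : t * (2 * (laplacian k f w - r * f w)) +
    t ^+ 2 * (dirichlet_energy k d - r * \sum_v d v ^+ 2) =
    dirichlet_energy k (fun v => f v + t * d v) - r * \sum_v (f v + t * d v) ^+ 2.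
  exact: ge0.
have -> : \sum_v (f v + t * d v) ^+ 2 =
    \sum_v f v ^+ 2 + 2 * t * f w + t ^+ 2 * \sum_v d v ^+ 2.
  rewrite -(sum_d f) !mulr_sumr -!big_split /=.
  by apply: eq_bigr => v _; ring.
have -> : dirichlet_energy k (fun v => f v + t * d v) =
    dirichlet_energy k f + 2 * t * laplacian k f w + t ^+ 2 * dirichlet_energy k d.
  have <- : 2^-1 * \sum_u \sum_(v | adj u v) k.-1%:R^-1 * ((f u - f v) * (d u - d v)) =
      laplacian k f w.
    rewrite (energy_green f d k2 stG) -(sum_d (laplacian k f)).
    by apply: eq_bigr => v _; rewrite mulrC.
  rewrite /dirichlet_energy ![_ * (2^-1 * _)]mulrCA -!mulrDr; congr (_ * _).
  rewrite !mulr_sumr -!big_split /=; apply: eq_bigr => u _.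
  by rewrite !mulr_sumr -!big_split /=; apply: eq_bigr => v _; ring.
by rewrite Ef; ring.
Qed.

Lemma dirichlet_energy_norm (G : hypergraph) (f : G -> R) :
  dirichlet_energy k (fun v => `|f v|) <= dirichlet_energy k f.
Proof.
rewrite /dirichlet_energy ler_pM2l ?invr_gt0 //; apply: ler_sum => u _.
apply: ler_sum => v _; rewrite ler_pM2l ?invr_gt0 //.
rewrite -[X in X <= _]real_normK ?num_real // -[X in _ <= X]real_normK ?num_real //.
by rewrite ler_pXn2r ?nnegrE // ler_dist_dist.
Qed.

Lemma nonneg_minimizer (G : hypergraph) : (exists v, v \in interior_vertices G) ->
  exists f : G -> R, [/\ dirichlet_function f, forall v, 0 <= f v,
    rayleigh k f = dirichlet_lambda R k G &
    forall g : G -> R, dirichlet_function g -> rayleigh k f <= rayleigh k g].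
Proof.
move=> iG; have [f df [lf fmin]] := dirichlet_lambda_min R k iG.
have dg : dirichlet_function (fun v => `|f v|).
  case: df => -[v fv] fb; split; first by exists v; rewrite normr_eq0.
  by move=> u ub; rewrite fb ?normr0.
have le : rayleigh k (fun v => `|f v|) <= rayleigh k f.
  rewrite /rayleigh.
  have -> : \sum_v `|f v| ^+ 2 = \sum_v f v ^+ 2.
    by apply: eq_bigr => v _; rewrite real_normK ?num_real.
  rewrite ler_pM2r ?dirichlet_energy_norm // invr_gt0; apply: sum_sq_gt0.
  by case: df.
exists (fun v => `|f v|); split=> //.
  by apply/eqP; rewrite lf eq_le le fmin.
by move=> g /fmin; apply: le_trans.
Qed.

Section OnEdges.
Variables (T : finType) (E : {set {set T}}).
Hypothesis tE : hypertree k E.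
Implicit Types f : T -> R.

Let st : supertree k (@Hypergraph T E). Proof. exact/supertreeP. Qed.
Let fE : forest E. Proof. by case: tE. Qed.

Lemma adj_sum f u : \sum_(v | @adj (@Hypergraph T E) u v) f v =
  \sum_(e in E | u \in e) (esum f e - f u).
Proof.
transitivity (\sum_(e in E | u \in e) \sum_(v in e | v != u) f v); last first.
  apply: eq_bigr => e /andP[_ ue]; rewrite /esum [X in _ = X - _](bigD1 u) //=.
  by rewrite addrAC subrr add0r.
rewrite (exchange_big_dep predT) //= big_mkcond; apply: eq_bigr => v _.
case: ifP => [/andP[uv /exists_inP[e eE /andP[ue ve]]]|nadj].
  rewrite (big_pred1 e) // => g; apply/idP/eqP => [|->]; last first.
    by rewrite eE ue ve eq_sym uv.
  by case/andP=> /andP[gE ug] /andP[vg _]; exact: (forest_meet fE gE eE ug vg ue ve uv).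
rewrite big_pred0 // => e; apply: contraFF nadj => /andP[/andP[eE ue] /andP[ve vu]].
by rewrite /adj eq_sym vu; apply/exists_inP; exists e; rewrite ?ue.
Qed.

Lemma laplacianE f u : @laplacian R k (@Hypergraph T E) f u = k.-1%:R^-1 * lap k E f u.
Proof.
rewrite /laplacian adj_sum sumrB /lap.
have -> : \sum_(e in E | u \in e) f u = (degree E u)%:R * f u.
  rewrite sumr_const mulr_natl; congr (_ *+ _).
  by apply: eq_card => e; rewrite inE.
rewrite -!/(degree E u) -[in k%:R](ltn_predK k2) -natr1.
by move: (esum f) => F; field; rewrite gt_eqF.
Qed.

Lemma dirichlet_energyE f :
  @dirichlet_energy R k (@Hypergraph T E) f = k.-1%:R^-1 * energy k E f.
Proof.
rewrite (@energy_laplacian R k (@Hypergraph T E) f k2 st).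
under eq_bigr do rewrite laplacianE.
under eq_bigr do rewrite mulrCA.
rewrite -mulr_sumr; congr (_ * _); rewrite /energy /lap.
under eq_bigr do rewrite mulrBr.
rewrite sumrB; congr (_ - _).
  by rewrite mulr_sumr; apply: eq_bigr => v _; ring.
under eq_bigr do rewrite mulr_sumr.
rewrite (exchange_big_dep (fun e => e \in E)) /=; last by move=> u e _ /andP[].
apply: eq_bigr => e eE; rewrite expr2 /esum -mulr_suml; congr (_ * _).
by apply: eq_bigl => v; rewrite eE.
Qed.

(** A vertex of maximal height is the top of no edge, so its parent edge is its only edge. *)
Lemma exists_leaf : E != set0 -> exists v, degree E v = 1%N.
Proof.
have [uE cE _] := tE; have E0 := uniform_neq0 k2 uE.
case/set0Pn=> e eE; have : (0 < #|e|)%N by rewrite uE // ltnW.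
case/card_gt0P=> x0 _; have hE := height_height_fun x0 cE.
set h := height _ in hE.
pose v := [arg max_(v > x0) h v].
have hmax w : (h w <= h v)%N by rewrite /v; case: arg_maxnP => // i _; apply.
have notop g : g \in E -> v \in g -> v != top x0 h g.
  move=> gE vg; apply/eqP => vt.
  have : (0 < #|g :\ v|)%N by have := k2; rewrite -(uE g gE) (cardsD1 v) vg.
  case/card_gt0P=> y; rewrite !inE => /andP[yv yg].
  rewrite vt in yv; have := hmax y; rewrite (top_lt hE fE E0 gE yg yv) -vt.
  by rewrite ltnn.
have vx : v != x0.
  apply/eqP => vx; have h0 w : h w = 0%N.
    by case: hE => H _ _; apply/eqP; rewrite -leqn0 (leq_trans (hmax w)) // leqn0 H vx.
  have := k2; rewrite -(uE e eE) => /card_gt1P[a [b [ae be ab]]].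
  have H (w : T) : w = x0 by apply/eqP; case: hE => <- _ _; rewrite h0.
  by rewrite (H a) (H b) eqxx in ab.
exists v; have [pE vp _] := pedgeP hE vx.
rewrite /degree (_ : [set _ in _ | _] = [set pedge E x0 h v]) ?cards1 //.
apply/setP => g; rewrite !inE; apply/andP/eqP => [[gE vg]|->//].
by have [_] := pedge_uniq hE fE E0 gE vg (notop g gE vg).
Qed.

(** Strong maximum principle: at an interior zero of [f] the equation makes all edge sums vanish, so
    [f] is zero on the neighbours, and this spreads through the connected tree. *)
Lemma eigenfunction_gt0 f mu : (forall v, 0 <= f v) -> (exists v, f v != 0) ->
  (forall v, degree E v = 1%N -> f v = 0) ->
  (forall v, degree E v != 1%N -> lap k E f v = mu * f v) ->
  forall u, degree E u != 1%N -> f u != 0.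
Proof.
have [uE cE _] := tE.
move=> f0 [x fx] fb feq u du; apply: contraNneq fx => fu; apply/eqP.
pose P v := f v = 0 /\ forall e, e \in E -> v \in e -> forall w, w \in e -> f w = 0.
have esum0 e : 0 <= esum f e by exact: sumr_ge0.
have intP v : f v = 0 -> degree E v != 1%N -> P v.
  move=> fv dv; split=> // e eE ve w we.
  have := feq v dv; rewrite /lap fv !mulr0 sub0r => /eqP.
  rewrite oppr_eq0 psumr_eq0 // => /allP/(_ e (mem_index_enum _)).
  rewrite eE ve /= psumr_eq0 // => /allP/(_ w (mem_index_enum _)).
  by rewrite we => /eqP.
suff [] : P x by [].
apply: (conn_ind (P := P)) (cE u x); first exact: intP.
move=> a b e [_ Pa] eE ae be; have fb0 : f b = 0 by exact: Pa be.
have [db|db] := eqVneq (degree E b) 1%N; last exact: intP.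
split=> // g gE bg w wg; suff ge : g = e by rewrite ge in wg; exact: (Pa e eE ae w wg).
have /eqP/cards1P[g0 Eg] := db.
have : g \in [set e in E | b \in e] by rewrite inE gE.
have : e \in [set e in E | b \in e] by rewrite inE eE.
by rewrite Eg !inE => /eqP -> /eqP ->.
Qed.

(** Zero energy would make [f] constant, hence equal to its value zero at a leaf. *)
Lemma eigenvalue_gt0 f mu : (exists v, f v != 0) ->
  (forall v, degree E v = 1%N -> f v = 0) -> E != set0 ->
  @dirichlet_energy R k (@Hypergraph T E) f = mu * \sum_v f v ^+ 2 -> 0 < mu.
Proof.
have [uE cE _] := tE.
move=> fn fb En muE; have Nf := @sum_sq_gt0 R (@Hypergraph T E) f fn.
have [v dv] := exists_leaf En; have [x fx] := fn.
rewrite -(pmulr_lgt0 _ Nf) -muE lt_neqAle; apply/andP; split; last first.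
  rewrite mulr_ge0 ?invr_ge0 //; apply: sumr_ge0 => a _; apply: sumr_ge0 => b _.
  by rewrite mulr_ge0 ?sqr_ge0 // invr_ge0 ltW.
apply: contraNneq fx => /esym/eqP; rewrite mulf_eq0 invr_eq0 pnatr_eq0 /=.
have pos a b : 0 <= k.-1%:R^-1 * (f a - f b) ^+ 2.
  by rewrite mulr_ge0 ?sqr_ge0 // invr_ge0 ltW.
rewrite psumr_eq0 => [/allP z|a _]; last by apply: sumr_ge0 => b _.
rewrite -(fb v dv); apply/eqP; apply: (conn_ind (P := fun y => f y = f v)) (cE v x) => //.
move=> a b e fa eE ae be; rewrite -fa; have [->//|ab] := eqVneq a b.
have /eqP := z a (mem_index_enum _); rewrite /= => /eqP.
rewrite psumr_eq0 => [/allP/(_ b (mem_index_enum _))|c _]; last exact: pos.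
have -> : @adj (@Hypergraph T E) a b.
  by rewrite /adj ab; apply/exists_inP; exists e; rewrite ?ae.
rewrite mulf_eq0 invr_eq0 gt_eqF //= expf_eq0 /= subr_eq0 => /eqP //.
Qed.

End OnEdges.

(** For a competitor of equal energy, [f] has Rayleigh quotient [r], and by extremality [r] bounds
    its first eigenvalue from below. So [f] is a minimizer there too and satisfies its eigenvalue
    equation. *)
Lemma faber_krahn_optimal (T : finType) (E : {set {set T}}) (pi : seq nat) :
  faber_krahn R k (supertree_class k pi) (@Hypergraph T E) ->
  (exists v, v \in interior_vertices (@Hypergraph T E)) ->
  exists f mu, @optimal R T k E f mu.
Proof.
move=> [[stE dsE] fk] iE; have tE : hypertree k E by exact/supertreeP.
have [f [df f0 lf fmin]] := nonneg_minimizer iE.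
have [fn fb'] := df.
have fb v : degree E v = 1%N -> f v = 0 by move=> dv; apply: fb'; rewrite inE; exact/eqP.
set r := rayleigh k f in lf fmin.
have lapf (E' : {set {set T}}) : hypertree k E' ->
    (forall v, (degree E' v == 1%N) = (degree E v == 1%N)) ->
    @rayleigh R k (@Hypergraph T E') f = r ->
    (forall g, @dirichlet_function R (@Hypergraph T E') g ->
       r <= @rayleigh R k (@Hypergraph T E') g) ->
    forall v, degree E v != 1%N -> lap k E' f v = k.-1%:R * r * f v.
  move=> tE' dE' rE' min v dv.
  have := @minimizer_laplacian (@Hypergraph T E') f.
  rewrite rE' => /(_ _ _ min v); rewrite laplacianE // => H.
  rewrite -mulrA -H ?mulVKf ?gt_eqF //.
  - exact/supertreeP.
  - split=> // u; rewrite inE => /eqP du; apply: fb; apply/eqP.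
    by rewrite -dE'; exact/eqP.
  - by rewrite !inE -/(degree E' v) dE'.
have lapE := lapf E tE (fun v => erefl) erefl fmin.
have Nf := @sum_sq_gt0 R (@Hypergraph T E) f fn.
have eE : @dirichlet_energy R k (@Hypergraph T E) f = r * \sum_v f v ^+ 2.
  by rewrite /r /rayleigh divfK // gt_eqF.
(* [lap] is [k - 1] times the Laplacian, so the eigenvalue is scaled likewise. *)
exists f, (k.-1%:R * r); split=> //.
- move=> v; apply/eqP/eqP => [fv|]; last exact: fb.
  apply/eqP; apply: contraT => dv.
  by have := eigenfunction_gt0 tE f0 fn fb lapE dv; rewrite fv eqxx.
- by move=> En; rewrite mulr_gt0 //; exact: (eigenvalue_gt0 tE fn fb En eE).
move=> E' tE' pE' bE'.
have df' : @dirichlet_function R (@Hypergraph T E') f.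
  split=> // v; rewrite inE => /eqP dv; apply: fb; apply/eqP.
  by rewrite -bE'; exact/eqP.
have clE' : supertree_class k pi (@Hypergraph T E').
  split; first exact/supertreeP.
  by apply: perm_trans dsE _; rewrite perm_sym.
have iE' : exists v, v \in interior_vertices (@Hypergraph T E').
  by have [v vi] := iE; exists v; move: vi; rewrite !inE -!/(degree _ v) bE'.
have [f' df2 [lf' fmin']] := dirichlet_lambda_min R k iE'.
have rr : r <= rayleigh k f' by rewrite -lf' lf; exact: fk.
have le : r <= @rayleigh R k (@Hypergraph T E') f.
  by apply: le_trans rr _; exact: fmin'.
have rW E1 : hypertree k E1 -> @rayleigh R k (@Hypergraph T E1) f =
    k.-1%:R^-1 * energy k E1 f / \sum_v f v ^+ 2.
  by move=> t1; rewrite /rayleigh dirichlet_energyE.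
split.
  move: le; rewrite /r !rW // ler_pM2r ?invr_gt0 // ler_pM2l // invr_gt0 //.
move=> ee; apply: lapf => //.
  by rewrite /r !rW // ee.
by move=> g dg; apply: le_trans rr _; exact: fmin'.
Qed.

End Rayleigh.

Lemma faber_krahn_SLO (R : realType) (k : nat) (pi : seq nat) (G : hypergraph) :
  (2 <= k)%N -> faber_krahn R k (supertree_class k pi) G ->
  (exists v, v \in interior_vertices G) -> has_SLO_ordering G.
Proof.
case: G => T E k2 fk iG; have [f [mu oE]] := faber_krahn_optimal k2 fk iG.
have [x0 _] := iG; exact: (optimal_SLO x0 k2 oE).
Qed.

(** * Uniqueness *)

(* The order of degrees along an SLO-ordering: interior vertices by increasing
   degree, then the boundary. *)
Definition degree_le : rel nat := fun a b => (b == 1%N) || (a != 1%N) && (a <= b)%N.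

Section Rank.
Local Open Scope nat_scope.
Variables (T : finType) (k : nat) (E : {set {set T}}) (v0 : T) (lt : rel T).
Hypotheses (k2 : 2 <= k) (tE : hypertree k E).
Hypothesis slo : @SLO_ordering (@Hypergraph T E) v0 lt.
Implicit Types (e : {set T}) (u v w x y p : T).

Let irr : irreflexive lt. Proof. exact: (SLO_irr slo). Qed.
Let tr : transitive lt. Proof. exact: (SLO_trans slo). Qed.
Let tot u v : u != v -> lt u v || lt v u. Proof. exact: (SLO_total slo). Qed.

Let h : T -> nat := @height (@Hypergraph T E) v0.
Let uE e : e \in E -> #|e| = k. Proof. by case: tE => H _ _; exact: H. Qed.
Let hE : height_fun E v0 h.
Proof. by apply: height_height_fun; case: tE. Qed.
Let fE : forest E. Proof. by case: tE. Qed.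
Let E0 : set0 \notin E. Proof. exact: (uniform_neq0 k2 uE). Qed.
Let h_eq0 v : (h v == 0) = (v == v0). Proof. by case: hE. Qed.
Let k1 : 0 < k.-1. Proof. by case: k k2 => [|[]]. Qed.

Notation tp := (top v0 h).
Notation pe := (pedge E v0 h).
Notation par := (parent E v0 h).

Definition rank v := #|[set u | lt u v]|.

Lemma ltE u v : lt u v = (rank u < rank v).
Proof.
have H x y : lt x y -> rank x < rank y.
  move=> xy; apply: proper_card; apply/properP; split.
    by apply/subsetP => z; rewrite !inE => /tr; exact.
  by exists x; rewrite !inE ?irr.
apply/idP/idP => [|uv]; first exact: H.
have [uv'|uv'] := eqVneq u v; first by rewrite uv' ltnn in uv.
by case/orP: (tot uv') => // /H; rewrite ltnNge (ltnW uv).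
Qed.

Lemma rank_inj : injective rank.
Proof.
move=> u v uv; apply/eqP; apply: contraT => /tot.
by rewrite !ltE uv ltnn.
Qed.

Lemma rank_lt v : rank v < #|T|.
Proof.
by rewrite -cardsT; apply: proper_card; apply/properP; split;
  [exact: subsetT|exists v; rewrite // inE irr].
Qed.

Definition unrank i : T := odflt v0 [pick v | rank v == i].

Lemma rankK : cancel rank unrank.
Proof.
by move=> v; rewrite /unrank; case: pickP => [u /eqP/rank_inj|/(_ v)]; rewrite ?eqxx.
Qed.

Lemma unrankK i : i < #|T| -> rank (unrank i) = i.
Proof.
move=> iT; pose r v : 'I_#|T| := Ordinal (rank_lt v).
have rinj : injective r by move=> u v /(congr1 val) /= /rank_inj.
have [g _ gK] : bijective r by apply: inj_card_bij rinj _; rewrite card_ord.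
by have /(congr1 val) /= := gK (Ordinal iT) => {1}<-; rewrite rankK [LHS](congr1 val (gK _)).
Qed.

Lemma card_rank i : i <= #|T| -> #|[set v | rank v < i]| = i.
Proof.
rewrite leq_eqVlt => /predU1P[->|iT].
  by rewrite -cardsT; apply: eq_card => v; rewrite !inE cardsT rank_lt.
by rewrite -{2}(unrankK iT); apply: eq_card => v; rewrite !inE ltE unrankK.
Qed.

(** By (S3) and (S5) the degrees listed by rank are sorted for [degree_le], and a list has only one
    sorted rearrangement. *)
Lemma degree_rank (pi : seq nat) : has_degree_sequence pi (@Hypergraph T E) ->
  forall v, degree E v = nth 0 (sort degree_le pi) (rank v).
Proof.
move=> dpi v; have le_tr : transitive degree_le.
  by move=> b a c; rewrite /degree_le; case: (eqVneq c 1) => //= _;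
    case: (eqVneq b 1) => //= _ /andP[-> ab]; apply: leq_trans.
have le_anti : antisymmetric degree_le.
  move=> a b; rewrite /degree_le.
  case: (eqVneq a 1) => [->|a1]; case: (eqVneq b 1) => [->|b1] //=.
  by rewrite -eqn_leq => /eqP.
have le_tot : total degree_le.
  move=> a b; rewrite /degree_le.
  by case: (eqVneq a 1); case: (eqVneq b 1) => //= *; exact: leq_total.
suff -> : sort degree_le pi = [seq degree E (unrank i) | i <- iota 0 #|T|].
  by rewrite (nth_map 0) ?size_iota ?rank_lt // nth_iota ?rank_lt // rankK.
apply: (sorted_eq le_tr le_anti); first exact: sort_sorted.
  rewrite sorted_map; apply: (sub_in_sorted (P := fun i => i < #|T|) (e := ltn)).
  - move=> i j; rewrite !unfold_in => iT jT ij /=.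
    have l : lt (unrank i) (unrank j) by rewrite ltE !unrankK.
    rewrite /degree_le; have [//|dj] := eqVneq (degree E (unrank j)) 1.
    have di : degree E (unrank i) != 1.
      by apply: contra dj => di; have := SLO_S3 slo l; rewrite !inE; apply.
    by rewrite di /=; apply: (SLO_S5 slo); rewrite ?inE.
  - by apply/allP => i; rewrite mem_iota.
  - exact: iota_ltn_sorted.
rewrite perm_sort; apply: (perm_trans dpi).
rewrite [X in perm_eq _ X](map_comp (degree E) unrank).
apply: (@perm_map _ _ (degree E) (enum T)).
apply: uniq_perm; first exact: enum_uniq.
  rewrite map_inj_in_uniq ?iota_uniq // => i j; rewrite !mem_iota /= => iT jT.
  by move=> /(congr1 rank); rewrite !unrankK.
move=> x; rewrite mem_enum; apply/esym/mapP; exists (rank x); last by rewrite rankK.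
by rewrite mem_iota rank_lt.
Qed.

Lemma rank_root v : (rank v == 0) = (v == v0).
Proof.
have r0 : rank v0 = 0.
  apply/eqP; rewrite cards_eq0; apply/eqP/setP => u; rewrite !inE.
  apply/negP => uv; have := SLO_S1 slo uv; rewrite -!/(h _).
  have /eqP -> : h v0 == 0 by rewrite h_eq0.
  rewrite leqn0 h_eq0 => /eqP uE'; by rewrite uE' irr in uv.
by apply/eqP/eqP => [rv|->//]; apply: rank_inj; rewrite rv.
Qed.

Lemma height_lt u v : h u < h v -> lt u v.
Proof.
move=> huv; have uv : u != v by apply: contraTneq huv => ->; rewrite ltnn.
by case/orP: (tot uv) => // /(SLO_S1 slo); rewrite -!/(h _) leqNgt huv.
Qed.

Lemma parent_lt u v : u != v0 -> v != v0 -> lt (par u) (par v) -> lt u v.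
Proof.
have isp w : w != v0 -> @is_parent (@Hypergraph T E) v0 (par w) w.
  move=> wv; have := is_parentE hE fE E0 (par w) w.
  rewrite wv eqxx /= => /andP[hw ex]; rewrite /is_parent hw andbT /adj ex andbT.
  by apply/eqP => pw; move: hw; rewrite {1}pw -/(h w) ltn_eqF.
by move=> uv vv; apply: (SLO_S2 slo); exact: isp.
Qed.

(** (S4) without lists. In the sorted edge, take the first entry not below [w] and its predecessor:
    they surround [w]. The predecessor has positive index, since the top of [e] comes before [x]. *)
Lemma edge_interval e x y w : e \in E -> x \in e -> x != tp e -> y \in e ->
  lt x w -> lt w y -> w \in e.
Proof.
move=> eE xe xt ye xw wy; apply: contraT => we.
pose le u v := (u == v) || lt u v.
have le_tot : total le.
  move=> a b; rewrite /le [b == a]eq_sym; case: eqVneq => //= ab; exact: tot.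
have le_tr : transitive le.
  move=> b a c; rewrite /le => /predU1P[->//|ab] /predU1P[<-|bc].
    by rewrite ab orbT.
  by rewrite (tr ab bc) orbT.
pose s := sort le (enum e).
have us : uniq s by rewrite sort_uniq enum_uniq.
have se : s =i e by move=> z; rewrite mem_sort mem_enum.
have ss : sorted lt s.
  have : sorted le s by exact: sort_sorted.
  move: us; case: s {se} => //= a s; elim: s a => //= b s IH a.
  rewrite inE negb_or => /andP[/andP[ab as_] us] /andP[lab ls].
  by rewrite IH ?andbT //; case/predU1P: lab => [abE|//]; rewrite abE eqxx in ab.
have nth_lt i j : i < size s -> j < size s -> i < j -> lt (nth w s i) (nth w s j).
  by move=> isz jsz; apply: (sorted_ltn_nth tr w ss).
pose m := find (fun z => ~~ lt z w) s.
have hasm : has (fun z => ~~ lt z w) s.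
  apply/hasP; exists y; rewrite ?se //; apply/negP => yw.
  by have := tr yw wy; rewrite irr.
have msz : m < size s by rewrite /m -has_find.
have xs : x \in s by rewrite se.
have xi : index x s < size s by rewrite index_mem.
have mx : index x s < m.
  rewrite ltnNge leq_eqVlt; apply/negP => /predU1P[mE|mlt].
    by have := nth_find w hasm; rewrite -/m mE nth_index // xw.
  have := nth_lt _ _ msz xi mlt; rewrite nth_index // => l.
  by have := nth_find w hasm; rewrite -/m (tr l xw).
have x0 : 0 < index x s.
  rewrite lt0n; apply: contra xt => /eqP i0.
  have te := top_in v0 h E0 eE; have ts : tp e \in s by rewrite se.
  apply: contraT => xt; have l : lt (tp e) x.
    by apply: height_lt; rewrite (top_lt hE fE E0 eE xe xt).
  have ti : index (tp e) s < size s by rewrite index_mem.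
  have t0 : 0 < index (tp e) s.
    rewrite lt0n; apply: contra xt => /eqP t0.
    by rewrite -(nth_index w xs) i0 -t0 nth_index.
  have s0 : 0 < size s by exact: leq_ltn_trans ti.
  have := nth_lt _ _ s0 ti t0; rewrite -{1}i0 !nth_index // => l'.
  by have := tr l l'; rewrite irr.
have m2 : 1 < m by exact: leq_ltn_trans x0 mx.
have mE : m.-1.+1 = m by rewrite prednK // ltnW.
have m1 : 0 < m.-1 by rewrite -ltnS mE.
have nm : lt (nth w s m.-1) w.
  have : m.-1 < m by rewrite -{2}mE.
  by move/(before_find w)/negbFE.
have nw : lt w (nth w s m).
  have nwm : w != nth w s m.
    by apply: contraNneq we => ->; rewrite -se mem_nth.
  case/orP: (tot nwm) => // l.
  by have := nth_find w hasm; rewrite -/m l.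
have := SLO_S4 slo eE ss se m1; rewrite mE => /(_ w msz we).
by rewrite nm nw.
Qed.

(** Initial segments among the non-root vertices, those that have a parent. *)
Definition down_closed (A : {set T}) : Prop :=
  forall u v, u != v0 -> v \in A -> rank u <= rank v -> u \in A.

(** The root has rank zero, so the [n]-th non-root vertex has rank [n], and an initial segment is
    determined by its size. *)
Lemma mem_down_closed (A : {set T}) v : v0 \notin A -> down_closed A -> v != v0 ->
  (v \in A) = ((rank v).-1 < #|A|).
Proof.
move=> A0 dA vv; have rv : 0 < rank v by rewrite lt0n rank_root.
have card m : 0 < m -> m <= #|T| -> #|[set u | (u != v0) && (rank u < m)]| = m.-1.
  move=> m0 mT; have := card_rank mT; rewrite (cardsD1 v0) inE.
  have /eqP -> : rank v0 == 0 by rewrite rank_root.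
  rewrite m0 /= add1n => mE; rewrite -{2}mE /=; apply: eq_card => u.
  by rewrite !inE.
apply/idP/idP => [vA|lt_]; last first.
  apply: contraTT lt_ => vA; rewrite -leqNgt -(card (rank v) rv (ltnW (rank_lt v))).
  apply: subset_leq_card; apply/subsetP => u uA; rewrite inE.
  have uv : u != v0 by apply: contraNneq A0 => <-.
  by rewrite uv ltnNge; apply: contra vA; exact: dA.
rewrite prednK // -[X in X <= _]/((rank v).+1.-1) -(card _ (ltn0Sn _) (rank_lt v)).
by apply: subset_leq_card; apply/subsetP => u; rewrite inE ltnS => /andP[uv /(dA _ _ uv vA)].
Qed.

Let before v : {set T} :=
  [set u | (u != v0) && [forall x, (x \in pe v :\ tp (pe v)) ==> lt u x]].

Let pe_mem u v : v != v0 -> (u \in pe v :\ tp (pe v)) = (u != v0) && (pe u == pe v).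
Proof.
move=> vv; have [pE vp pv] := pedgeP hE vv; rewrite !inE.
apply/andP/andP => [[ut up]|[uv /eqP <-]].
  by have [uv uE'] := pedge_uniq hE fE E0 pE up ut; rewrite uE' uv.
by have [_ up pu] := pedgeP hE uv; rewrite eq_sym.
Qed.

Let card_pe v : v != v0 -> #|pe v :\ tp (pe v)| = k.-1.
Proof.
move=> vv; have [pE vp pv] := pedgeP hE vv.
by rewrite -(uE pE) (cardsD1 (tp (pe v)) (pe v)) (top_in v0 h E0 pE).
Qed.

Let before_disjoint v : v != v0 -> [disjoint before v & pe v :\ tp (pe v)].
Proof.
move=> vv; rewrite -setI_eq0; apply/eqP/setP => u; rewrite in_set0 in_setI.
apply/negP => /andP[]; rewrite [in X in X -> _]inE => /andP[_ /forallP/(_ u)].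
by move=> + uP; rewrite uP irr.
Qed.

Let before_down v : v != v0 -> down_closed (before v) /\
  down_closed (before v :|: pe v :\ tp (pe v)).
Proof.
move=> vv; have [pE vp pv] := pedgeP hE vv.
have d1 : down_closed (before v).
  move=> u w uv; rewrite !inE uv /= => /andP[wv /forallP H] le.
  apply/forallP => x; apply/implyP => xP; have := implyP (H x) xP.
  by rewrite !ltE; apply: leq_ltn_trans.
split=> // u w uv; rewrite in_setU => /orP[wB|wP] le.
  by rewrite in_setU (d1 u w).
rewrite in_setU orbC; have [//|uP] := boolP (u \in pe v :\ tp (pe v)).
have [wt we] : w != tp (pe v) /\ w \in pe v by apply/andP; rewrite -in_setD1.
have uw : u != w by apply: contraNneq uP => ->.
have luw : lt u w by rewrite ltE ltn_neqAle le andbT (inj_eq rank_inj).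
rewrite inE uv /=; apply/forallP => x; apply/implyP => xP.
have ux : u != x by apply: contraNneq uP => ->.
case/orP: (tot ux) => // lxu.
have [xt xe] : x != tp (pe v) /\ x \in pe v by apply/andP; rewrite -in_setD1.
have ue := edge_interval pE xe xt we lxu luw.
suff ut : u != tp (pe v) by rewrite in_setD1 ut ue in uP.
apply: contraTneq lxu => ->; apply/negP => l.
have l' : lt (tp (pe v)) x by apply: height_lt; rewrite (top_lt hE fE E0 pE xe xt).
by have := tr l l'; rewrite irr.
Qed.

Let before_card v : v != v0 -> exists j, #|before v| = j * k.-1.
Proof.
move=> vv; have [pE vp pv] := pedgeP hE vv.
exists #|pe @: before v|; rewrite -sum1_card.
rewrite (partition_big_imset pe) /= -sum_nat_const; apply: eq_bigr => g /imsetP[u uB ->].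
have uv : u != v0 by move: uB; rewrite inE => /andP[].
rewrite -(card_pe uv) -sum1_card; apply: eq_bigl => w; rewrite pe_mem //.
apply/andP/andP => [[+ ->]|[wv pw]]; first by rewrite inE => /andP[->].
split=> //; rewrite inE wv; apply/forallP => x; apply/implyP => xP.
have ux : lt u x by move: uB; rewrite inE => /andP[_ /forallP/(_ x)/implyP]; exact.
have uP : pe u != pe v.
  apply: contraTneq (uB) => uP; apply/negP => _.
  have : u \in before v :&: (pe v :\ tp (pe v)) by rewrite in_setI uB pe_mem // uv uP eqxx.
  have := before_disjoint vv; rewrite -setI_eq0 => /eqP ->; by rewrite inE.
have xP' := xP; rewrite pe_mem // in xP'; have /andP[xv /eqP xpe] := xP'.
have wx : w != x.
  by apply: contraNneq uP => wx; rewrite -xpe -wx eq_sym.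
case/orP: (tot wx) => // lxw.
have [puE uup puu] := pedgeP hE uv.
have wu : w \in pe u by rewrite -(eqP pw); have [] := pedgeP hE wv.
have ut : u != tp (pe u) by rewrite eq_sym.
have xu := edge_interval puE uup ut wu ux lxw.
have xt : x != tp (pe u).
  apply: contraTneq ux => ->; apply/negP => l.
  have l' : lt (tp (pe u)) u by apply: height_lt; rewrite (top_lt hE fE E0 puE uup ut).
  by have := tr l l'; rewrite irr.
by have [_ puxE] := pedge_uniq hE fE E0 puE xu xt; rewrite puxE xpe eqxx in uP.
Qed.

(** The non-top vertices of each edge form an interval of size [k.-1], and whole intervals precede
    it. So the ranks from 1 on are cut into consecutive blocks of length [k.-1], one for each
    edge. *)
Lemma pedge_rank u v : u != v0 -> v != v0 ->
  (pe u == pe v) = ((rank u).-1 %/ k.-1 == (rank v).-1 %/ k.-1).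
Proof.
move=> uv vv.
have nb w : v0 \notin before w by rewrite inE eqxx.
have nb' w : w != v0 -> v0 \notin before w :|: pe w :\ tp (pe w).
  by move=> wv; rewrite in_setU negb_or nb pe_mem // eqxx.
have cU w : w != v0 -> #|before w :|: pe w :\ tp (pe w)| = #|before w| + k.-1.
  move=> wv; rewrite cardsU card_pe //.
  by have := before_disjoint wv; rewrite -setI_eq0 => /eqP ->; rewrite cards0 subn0.
have chunk w x : w != v0 -> x != v0 -> (pe x == pe w) =
    (#|before w| <= (rank x).-1 < #|before w| + k.-1).
  move=> wv xv; have [d1 d2] := before_down wv.
  have H1 := mem_down_closed (nb w) d1 xv.
  have H2 := mem_down_closed (nb' w wv) d2 xv.
  rewrite -cU // -H2 leqNgt -H1 in_setU pe_mem // xv /=.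
  case: (boolP (x \in before w)) => //= xB; apply/negP => xw.
  have : x \in before w :&: (pe w :\ tp (pe w)) by rewrite in_setI xB pe_mem // xv.
  by have := before_disjoint wv; rewrite -setI_eq0 => /eqP ->; rewrite inE.
have [j jE] := before_card vv.
have div x : x != v0 -> (pe x == pe v) = ((rank x).-1 %/ k.-1 == j).
  move=> xv; rewrite chunk // jE -mulSnr eqn_leq andbC.
  by rewrite leq_divRL // -[_ %/ _ <= _]ltnS ltn_divLR.
by rewrite div //; have := div v vv; rewrite eqxx => /esym/eqP ->.
Qed.

(** The number of children of the vertices of rank below [l]: each edge brings [k.-1] of them,
    except the parent edge, which only the root lacks. *)
Definition child_count l : nat :=
  \sum_(v | rank v < l) k.-1 * (degree E v - (rank v != 0)).

Lemma card_children p : #|[set v | (v != v0) && (par v == p)]| =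
  k.-1 * (degree E p - (rank p != 0)).
Proof.
rewrite rank_root -sum1_card (partition_big pe [pred e in E | tp e == p]) /=; last first.
  by move=> v; rewrite inE => /andP[/(pedgeP hE)[-> _ _]].
rewrite (eq_bigr (fun=> k.-1)); last first.
  move=> e /andP[eE /eqP te]; rewrite -(uE eE) (cardsD1 (tp e) e) (top_in v0 h E0 eE).
  rewrite -sum1_card; apply: eq_bigl => v; rewrite !inE.
  apply/andP/andP => [[/andP[vv _] /eqP pv]|[vt ve]].
    by have [_ vp pv'] := pedgeP hE vv; rewrite -pv eq_sym.
  have [vv eE'] := pedge_uniq hE fE E0 eE ve vt.
  by rewrite -eE' eqxx /parent -eE' te eqxx vv.
rewrite sum_nat_const mulnC; congr (_ * _).
have [->|pv] := eqVneq p v0.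
  rewrite subn0 /degree -[in RHS]cardsE; apply: eq_card => e; rewrite !inE.
  apply/andP/andP => [[eE /eqP te]|[eE ve]].
    by split=> //; rewrite -te (top_in v0 h E0 eE).
  split=> //; apply: contraT => te; have [] := pedge_uniq hE fE E0 eE ve.
    by rewrite eq_sym.
  by rewrite eqxx.
rewrite /degree (cardsD1 (pe p)) inE; have [pE pp ppp] := pedgeP hE pv.
rewrite pE pp add1n subn1 /=; apply: eq_card => e; rewrite !inE.
apply/andP/and3P => [[eE /eqP te]|[ep eE pe']].
  split=> //; last by rewrite -te (top_in v0 h E0 eE).
  by apply: contraNneq ppp => ee; rewrite /parent -ee te.
split=> //; apply: contraNT ep => te; have [|_ ->//] := pedge_uniq hE fE E0 eE pe'.
by rewrite eq_sym.
Qed.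

(** By (S2) the vertices whose parent has rank below [l] form an initial segment, of size
    [child_count l]. The ranks of parents thus depend only on the degrees in rank order. *)
Lemma parent_rank v l : v != v0 ->
  (rank (par v) < l) = ((rank v).-1 < child_count l).
Proof.
move=> vv; pose A := [set u | (u != v0) && (rank (par u) < l)].
have -> : child_count l = #|A|.
  rewrite /child_count -sum1_card.
  rewrite [RHS](partition_big par [pred p | rank p < l]) /=; last first.
    by move=> u; rewrite /A !inE => /andP[].
  apply: eq_bigr => p pl; rewrite -card_children -sum1_card; apply: eq_bigl => u.
  rewrite /A !inE; apply/andP/andP => [[uv /eqP pu]|[/andP[uv _] ->]] //.
  by rewrite uv pu eqxx; split.
rewrite -mem_down_closed //; first by rewrite inE vv.
  by rewrite inE eqxx.
move=> u w uv; rewrite !inE uv => /andP[wv pw] le /=.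
apply: leq_ltn_trans pw; rewrite leqNgt -ltE; apply/negP => /(parent_lt wv uv).
by rewrite ltE ltnNge le.
Qed.

End Rank.

(** * The isomorphism matching ranks *)

Section SLOUnique.
Local Open Scope nat_scope.
Variables (T T' : finType) (k : nat) (E : {set {set T}}) (E' : {set {set T'}}).
Variables (v0 : T) (v0' : T') (lt : rel T) (lt' : rel T').
Hypotheses (k2 : 2 <= k) (tE : hypertree k E) (tE' : hypertree k E').
Hypothesis slo : @SLO_ordering (@Hypergraph T E) v0 lt.
Hypothesis slo' : @SLO_ordering (@Hypergraph T' E') v0' lt'.
Variable pi : seq nat.
Hypothesis dpi : has_degree_sequence pi (@Hypergraph T E).
Hypothesis dpi' : has_degree_sequence pi (@Hypergraph T' E').

Definition rank_map v := unrank v0' lt' (rank lt v).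

Let cT : #|T| = #|T'|.
Proof.
have := perm_size dpi'; rewrite (perm_size dpi) !size_map !cardT !enumT; exact.
Qed.

Lemma rank_rank_map v : rank lt' (rank_map v) = rank lt v.
Proof. by rewrite (unrankK slo') // -cT (rank_lt slo). Qed.

Lemma rank_map_edge e : e \in E -> rank_map @: e \in E'.
Proof.
have uE e' : e' \in E -> #|e'| = k by case: tE => H _ _; exact: H.
have uE' e' : e' \in E' -> #|e'| = k by case: tE' => H _ _; exact: H.
have E0 := uniform_neq0 k2 uE; have E0' := uniform_neq0 k2 uE'.
have [_ cE fE] := tE; have [_ cE' fE'] := tE'.
have hE := height_height_fun v0 cE; have hE' := height_height_fun v0' cE'.
set h := height _ in hE; set h' := height _ in hE'.
move=> eE; have te := top_in v0 h E0 eE.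
have : 0 < #|e :\ top v0 h e|.
  by have := k2; rewrite -(uE e eE) (cardsD1 (top v0 h e)) te.
case/card_gt0P=> x; rewrite !inE => /andP[xt xe].
have [xv xpe] := pedge_uniq hE fE E0 eE xe xt.
have root v : (rank_map v == v0') = (v == v0).
  by rewrite -(rank_root tE' slo') rank_rank_map (rank_root tE slo).
have xv' : rank_map x != v0' by rewrite root.
have [pE' xp' px'] := pedgeP hE' xv'.
have inj : injective rank_map.
  by move=> a b /(congr1 (rank lt')); rewrite !rank_rank_map => /(rank_inj slo).
(* Both sides have [k] elements, so an inclusion is enough: [pedge_rank] places the non-top vertices
   and [parent_rank] the top. *)
suff -> : rank_map @: e = pedge E' v0' h' (rank_map x) by [].
apply/eqP; rewrite eqEcard card_imset // uE // uE' // leqnn andbT.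
apply/subsetP => _ /imsetP[y ye ->].
have [->|yt] := eqVneq y (top v0 h e).
  suff -> : rank_map (top v0 h e) = parent E' v0' h' (rank_map x)
    by exact: (top_in v0' h' E0' pE').
  apply: (rank_inj slo'); rewrite rank_rank_map.
  have <- : parent E v0 h x = top v0 h e by rewrite /parent -xpe.
  have ccE l : child_count k E' lt' l = child_count k E lt l.
    rewrite /child_count (reindex rank_map); last first.
      by apply: onW_bij; apply: (inj_card_bij inj); rewrite cT.
    apply: eq_big => [v|v _]; rewrite rank_rank_map //.
    by rewrite (degree_rank slo' dpi') rank_rank_map -(degree_rank slo dpi).
  have H l : (rank lt (parent E v0 h x) < l) =
      (rank lt' (parent E' v0' h' (rank_map x)) < l).
    by rewrite (parent_rank k2 tE slo) // (parent_rank k2 tE' slo') // rank_rank_map ccE.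
  by apply/eqP; rewrite eqn_leq -ltnS H ltnSn /= -ltnS -H ltnSn.
have [yv ype] := pedge_uniq hE fE E0 eE ye yt.
have yv' : rank_map y != v0' by rewrite root.
have : pedge E v0 h y == pedge E v0 h x by rewrite -xpe -ype.
rewrite (pedge_rank k2 tE slo) // -!rank_rank_map -(pedge_rank k2 tE' slo') //.
by move=> /eqP <-; have [] := pedgeP hE' yv'.
Qed.

End SLOUnique.

Lemma SLO_isomorphic (k : nat) (pi : seq nat) (G H : hypergraph) : (2 <= k)%N ->
  supertree_class k pi G -> supertree_class k pi H ->
  has_SLO_ordering G -> has_SLO_ordering H -> isomorphic G H.
Proof.
case: G => T E; case: H => T' E' k2 [/supertreeP tE dE] [/supertreeP tE' dE'].
move=> [v0 [lt slo]] [v0' [lt' slo']].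
have K1 : cancel (rank_map v0' lt lt') (rank_map v0 lt' lt).
  move=> v; rewrite /rank_map -/(rank_map v0' lt lt' v).
  by rewrite (rank_rank_map slo slo' dE dE') (rankK slo).
have K2 : cancel (rank_map v0 lt' lt) (rank_map v0' lt lt').
  move=> v; rewrite /rank_map -/(rank_map v0 lt' lt v).
  by rewrite (rank_rank_map slo' slo dE' dE) (rankK slo').
exists (rank_map v0' lt lt'); first by exists (rank_map v0 lt' lt).
move=> e; apply/idP/idP => [H|]; last first.
  exact: (rank_map_edge k2 tE tE' slo slo' dE dE').
have := rank_map_edge k2 tE' tE slo' slo dE' dE H.
by rewrite -imset_comp (eq_imset _ (g := id)) ?imset_id.
Qed.

(** * Isomorphism invariance and existence *)

Section Isomorphism.

Lemma isomorphic_sym (G H : hypergraph) : isomorphic G H -> isomorphic H G.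
Proof.
case=> phi [psi phiK psiK] edges; exists psi; first by exists phi.
by move=> e; rewrite -edges -imset_comp (eq_imset _ (g := id)) ?imset_id.
Qed.

Lemma isomorphic_on (G : hypergraph) (T : finType) : #|G| = #|T| ->
  exists E : {set {set T}}, isomorphic G (@Hypergraph T E).
Proof.
move=> c; pose phi (v : G) : T := enum_val (cast_ord c (enum_rank v)).
have bij : bijective phi.
  exists (fun w => enum_val (cast_ord (esym c) (enum_rank w))) => v.
    by rewrite enum_valK cast_ordK enum_rankK.
  by rewrite /phi enum_valK cast_ordKV enum_rankK.
have inj := imset_inj (bij_inj bij).
exists [set phi @: e | e : {set G} in hedges G], phi => //= e.
by rewrite mem_imset.
Qed.

Lemma conn_map (T T' : finType) (E : {set {set T}}) (E' : {set {set T'}})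
    (phi : T -> T') x y :
  (forall e, e \in E -> phi @: e \in E') -> conn E x y -> conn E' (phi x) (phi y).
Proof.
move=> sub; apply: (conn_ind (P := fun z => conn E' (phi x) (phi z))).
  exact: connxx.
move=> a b e xa eE ae be; apply: conn_trans xa _.
by apply: (conn_edge (sub _ eE)); exact: imset_f.
Qed.

Lemma isomorphic_supertree k (G H : hypergraph) :
  isomorphic G H -> supertree k G -> supertree k H.
Proof.
case: G => T E; case: H => T' E' [phi [psi phiK psiK] /= edges].
move=> /supertreeP[uE cE fE]; apply/supertreeP.
have iso (e : {set T'}) : phi @: (psi @: e) = e.
  by rewrite -imset_comp (eq_imset _ (g := id)) ?imset_id.
have edges' (e : {set T'}) : (psi @: e \in E) = (e \in E') by rewrite -edges iso.
have pinj := can_inj psiK.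
split=> [e eE'|x y|e x y eE' xe ye c].
- by rewrite -(card_imset _ pinj); apply: uE; rewrite edges'.
- rewrite -(psiK x) -(psiK y); apply: conn_map (cE _ _) => e.
  by rewrite -edges.
- apply: (pinj); apply: (fE (psi @: e)); rewrite ?edges' ?imset_f //.
  apply: conn_map c => g; rewrite !inE edges' => /andP[ge ->].
  by rewrite andbT (inj_eq (imset_inj pinj)).
Qed.

Section Transport.
Variables (G H : hypergraph) (phi : G -> H).
Hypothesis bij : bijective phi.
Hypothesis edges : forall e : {set G}, (phi @: e \in hedges H) = (e \in hedges G).

Let inj : injective phi. Proof. exact: bij_inj. Qed.

Lemma imset_edgeP (e' : {set H}) : e' \in hedges H ->
  exists2 e, e \in hedges G & e' = phi @: e.
Proof.
have [psi phiK psiK] := bij; move=> eH.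
have eE : e' = phi @: (psi @: e').
  by rewrite -imset_comp (eq_imset _ (g := id)) ?imset_id.
by exists (psi @: e'); rewrite // -edges -eE.
Qed.

Lemma deg_transport v : deg (phi v) = deg v.
Proof.
rewrite /deg -(card_imset _ (imset_inj inj)); apply: eq_card => e'.
rewrite !inE; apply/andP/imsetP => [[/imset_edgeP[e eG ->]]|[e]].
  by rewrite mem_imset // => ve; exists e; rewrite // inE eG.
by rewrite inE => /andP[eG ve] ->; rewrite edges mem_imset.
Qed.

Lemma adj_transport u v : adj (phi u) (phi v) = adj u v.
Proof.
rewrite /adj (inj_eq inj); congr (_ && _); apply/exists_inP/exists_inP.
  by move=> [_ /imset_edgeP[e eG ->]]; rewrite !mem_imset //; exists e.
by move=> [e eG uv]; exists (phi @: e); rewrite ?edges // !mem_imset.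
Qed.

Let reindex_phi (V : nmodType) (P : pred H) (F : H -> V) :
  \sum_(v | P v) F v = \sum_(v | P (phi v)) F (phi v).
Proof. by rewrite (reindex phi) //; apply: onW_bij. Qed.

Lemma rayleigh_transport (R : realType) k (f : H -> R) :
  rayleigh k f = rayleigh k (fun v => f (phi v)).
Proof.
rewrite /rayleigh /dirichlet_energy !reindex_phi; congr (_ * _ / _).
apply: eq_bigr => u _; rewrite reindex_phi; apply: eq_bigl => v.
exact: adj_transport.
Qed.

Lemma degree_sequence_transport pi :
  has_degree_sequence pi G -> has_degree_sequence pi H.
Proof.
move=> /perm_trans; apply; rewrite -(eq_map deg_transport) (map_comp (@deg H)).
apply: perm_map; apply: uniq_perm; rewrite -?enumT ?map_inj_uniq -?enumT ?enum_uniq //.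
move=> v; rewrite mem_enum; have [psi phiK psiK] := bij.
by apply/mapP; exists (psi v); rewrite ?mem_enum.
Qed.

Lemma lambda_transport (R : realType) k :
  (exists v, v \in interior_vertices H) ->
  dirichlet_lambda R k G <= dirichlet_lambda R k H.
Proof.
move=> iH; have [psi phiK psiK] := bij.
have iG : exists v, v \in interior_vertices G.
  by have [v vi] := iH; exists (psi v); move: vi; rewrite !inE -deg_transport psiK.
have [f [[v fv] fb] [-> _]] := dirichlet_lambda_min R k iH.
have [g dg [-> gmin]] := dirichlet_lambda_min R k iG.
rewrite rayleigh_transport; apply: gmin; split.
  by exists (psi v); rewrite psiK.
by move=> u; rewrite inE -deg_transport => du; apply: fb; rewrite inE.
Qed.

End Transport.

Lemma isomorphic_class k pi (G H : hypergraph) :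
  isomorphic G H -> supertree_class k pi G -> supertree_class k pi H.
Proof.
move=> iso [stG dG]; split; first exact: isomorphic_supertree stG.
by have [phi bij edges] := iso; exact: (degree_sequence_transport bij edges).
Qed.

Lemma isomorphic_lambda (R : realType) k (G H : hypergraph) : isomorphic G H ->
  (exists v, v \in interior_vertices H) ->
  dirichlet_lambda R k G <= dirichlet_lambda R k H.
Proof. by case=> phi bij edges; exact: (lambda_transport bij edges). Qed.

Lemma class_interior k pi (G H : hypergraph) :
  supertree_class k pi G -> (exists v, v \in interior_vertices G) ->
  supertree_class k pi H -> exists v, v \in interior_vertices H.
Proof.
move=> [_ dG] [v vi] [_ dH].
have : deg v \in pi by rewrite (perm_mem dG); apply: map_f; rewrite -?enumT mem_enum.
rewrite (perm_mem dH) => /mapP[w _ vw]; exists w; move: vi.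
by rewrite !inE vw.
Qed.

(** Members of the class have [size pi] vertices, so up to isomorphism they are among the finitely
    many hypergraphs on ['I_(size pi)]. *)
Lemma faber_krahn_exists (R : realType) k pi (G0 : hypergraph) :
  supertree_class k pi G0 -> (exists v, v \in interior_vertices G0) ->
  exists G, faber_krahn R k (supertree_class k pi) G.
Proof.
move=> cG0 iG0; pose hyp (A : {set {set 'I_(size pi)}}) := Hypergraph A.
have model H : supertree_class k pi H -> exists A, isomorphic H (hyp A).
  move=> [_ dH]; apply: isomorphic_on.
  by rewrite card_ord (perm_size dH) size_map cardT enumT.
have [A0 iso0] := model _ cG0.
pose P A := `[< supertree_class k pi (hyp A) >].
have PA0 : P A0 by apply/asboolP; exact: isomorphic_class cG0.
pose A := [arg min_(A < A0 | P A) dirichlet_lambda R k (hyp A)]%O.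
have [PA Amin] : P A /\
    forall B, P B -> dirichlet_lambda R k (hyp A) <= dirichlet_lambda R k (hyp B).
  by rewrite /A; case: arg_minP.
exists (hyp A); split=> [|H cH]; first exact/asboolP.
have [B isoB] := model _ cH; have cB := isomorphic_class isoB cH.
apply: le_trans (Amin B _) _; first exact/asboolP.
apply: isomorphic_lambda; first exact: isomorphic_sym.
exact: class_interior cG0 iG0 cH.
Qed.

End Isomorphism.

Theorem theorem2p2 (R : realType) (k : nat) (pi : seq nat)
    (hk : (2 <= k)%N)
    (hpi : exists G0, supertree_class k pi G0 /\
             exists v : G0, v \in interior_vertices G0) :
  (forall G, supertree_class k pi G ->
     (faber_krahn R k (supertree_class k pi) G <-> has_SLO_ordering G)) /\
  (exists G, faber_krahn R k (supertree_class k pi) G /\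
     forall H, faber_krahn R k (supertree_class k pi) H -> isomorphic H G).
Proof.
have [G0 [cG0 iG0]] := hpi.
have int H : supertree_class k pi H -> exists v, v \in interior_vertices H.
  exact: class_interior cG0 iG0.
have [M fkM] := faber_krahn_exists R cG0 iG0.
have slo H : faber_krahn R k (supertree_class k pi) H -> has_SLO_ordering H.
  by move=> fkH; apply: (faber_krahn_SLO hk fkH); apply: int; case: fkH.
have [cM minM] := fkM; have sloM := slo M fkM.
split.
  move=> G cG; split; first exact: slo.
  move=> sloG; split=> // H cH; apply: le_trans (minM H cH).
  apply: isomorphic_lambda (int M cM).
  exact: (SLO_isomorphic hk cG cM sloG sloM).
exists M; split=> // H fkH; have [cH _] := fkH.
exact: (SLO_isomorphic hk cH cM (slo H fkH) sloM).
Qed.
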